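(* For integers $b\ge0$ and $n\ge1$, the number $jp_b(n)$ of multiplex juggling patterns with exactly $b$ balls and minimal period $n$ is \[ jp_b(n)=\frac1n\sum_{d\mid n}\mu\!\left(\tfrac{n}{d}\right)\left(\operatorname{trace}(A_b^d)-\sum_{i=0}^{b-1}\operatorname{trace}(A_i^d)\right), \] where $\mu$ is the M\''obius function.
   Context: For an integer $b\ge 0$, an ordered partition of $b$ is a finite sequence $(q_1,\ldots,q_k)$ of positive integers summing to $b$ (for $b=0$ the only one is the empty sequence). An ordered partition $(q_1,\ldots,q_k)$ with $k\ge1$ is nontrivially embedded into an ordered partition $(r_1,\ldots,r_\ell)$ by a choice of indices $1\le i_2<\cdots<i_k\le \ell$ with $q_j\le r_{i_j}$ for $2\le j\le k$; different index tuples count as different embeddings. A card for $b$ balls is either (i) a trivial card, given by an ordered partition $q$ of $b$, with left and right partitions both $q$; or (ii) a throw card, given by ordered partitions $q$ ($k\ge1$ parts) and $r$ of $b$ together with a nontrivial embedding of $q$ into $r$, with left partition $q$ and right partition $r$. Different index tuples give different cards, and a throw card is distinct from the trivial card even when $q=r$. $A_b$ is the square matrix with rows and columns indexed by the ordered partitions of $b$ whose $(u,v)$ entry is the number of cards for $b$ balls with left partition $u$ and right partition $v$. A multiplex siteswap of length $n$ is a sequence $(M_0,\ldots,M_{n-1})$, indexed by $t\in\mathbb{Z}/n\mathbb{Z}$, of finite multisets of positive integers (empty means no throw) such that for every $t$, $|M_t|$ equals the number of pairs $(s,h)$ with $h$ an element of $M_s$ (with multiplicity) and $s+h\equiv t\pmod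 n$; its number of balls is $\frac1n\sum_t\sum_{h\in M_t}h$. Its minimal period is the least $d\ge1$ with $M_{t+d}=M_t$ for all $t$. A multiplex juggling pattern with $b$ balls and minimal period $n$ is an orbit, under cyclic rotation of indices, of multiplex siteswaps of length $n$ with $b$ balls and minimal period $n$. *)

(* Defs.v *)
From mathcomp Require Import all_boot all_order all_algebra.
Set Implicit Arguments. Unset Strict Implicit. Unset Printing Implicit Defensive.
Import Order.TTheory GRing.Theory Num.Theory.

Definition is_composition (b : nat) (q : seq nat) : bool :=
  all (fun x => 0 < x) q && (sumn q == b).

Fixpoint words (len m : nat) : seq (seq nat) :=
  match len with
  | 0 => [:: [::]]
  | l.+1 => [seq x :: w | x <- iota 1 m, w <- words l m]
  end.

(* an explicit duplicate-free enumeration of the ordered partitions of b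
   (a composition of b has at most b parts, each between 1 and b) *)
Definition comps (b : nat) : seq (seq nat) :=
  [seq s <- flatten [seq words l b | l <- iota 0 b.+1] | is_composition b s].

(* number of nontrivial embeddings of q = (q_1,...,q_k) (k >= 1) into r:
   index tuples 1 <= i_2 < ... < i_k <= l with q_j <= r_{i_j} for 2<=j<=k
   (indices below are 0-based positions in r). For q = [::] there is none. *)
Definition num_embeddings (q r : seq nat) : nat :=
  match q with
  | [::] => 0
  | _ :: q' =>
      #|[set t : (size q').-tuple 'I_(size r) |
          sorted ltn (map val t) && all2 (fun x (i : 'I_(size r)) => x <= nth 0 r i) q' t]|
  end.

(* number of cards (trivial + throw cards) with left partition u and right v *)
Definition num_cards (u v : seq nat) : nat := (u == v) + num_embeddings u v.

Definition Amx (b : nat) : 'M[int]_(size (comps b)) :=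
  \matrix_(i, j) Posz (num_cards (nth [::] (comps b) i) (nth [::] (comps b) j)).

Definition squarefree (n : nat) : bool := all (fun p => logn p n == 1) (primes n).
Definition mobius (n : nat) : int :=
  if n == 0 then 0%R else if squarefree n then ((-1) ^+ size (primes n))%R else 0%R.

(* A multiset of positive integers is represented by a seq nat, two such being
   equal as multisets iff perm_eq. A multiplex siteswap of length n is a list
   s of n such multisets, M_t = nth [::] s t for t < n (indices mod n). *)
Definition Mt (s : seq (seq nat)) (t : nat) : seq nat := nth [::] s (t %% size s).

Definition is_mss (n : nat) (s : seq (seq nat)) : Prop :=
  size s = n /\
  (forall t, t < n -> all (fun h => 0 < h) (Mt s t)) /\
  (forall t, t < n ->
     size (Mt s t) = \sum_(u < n) count (fun h => (u + h) %% n == t) (Mt s u)).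

Definition ball_sum (s : seq (seq nat)) : nat :=
  \sum_(t < size s) sumn (Mt s t).

Definition has_balls (n b : nat) (s : seq (seq nat)) : Prop :=
  ((ball_sum s)%:R / n%:R = b%:R :> rat)%R.

Definition is_period (s : seq (seq nat)) (d : nat) : Prop :=
  forall t, t < size s -> perm_eq (Mt s (t + d)) (Mt s t).

Definition minimal_period (s : seq (seq nat)) (d : nat) : Prop :=
  0 < d /\ is_period s d /\ (forall d', 0 < d' -> is_period s d' -> d <= d').

Definition pattern_ss (b n : nat) (s : seq (seq nat)) : Prop :=
  is_mss n s /\ has_balls n b s /\ minimal_period s n.

Definition rot_equiv (s s' : seq (seq nat)) : Prop :=
  size s' = size s /\
  exists i, forall t, t < size s -> perm_eq (Mt s' t) (Mt s (t + i)).

(* reps is a system of representatives of the rotation orbits of multiplex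
   siteswaps of length n with b balls and minimal period n; its size is then
   the number jp_b(n) of multiplex juggling patterns. *)
Definition orbit_reps (b n : nat) (reps : seq (seq (seq nat))) : Prop :=
  (forall s, s \in reps -> pattern_ss b n s) /\
  (forall i j, i < size reps -> j < size reps ->
     rot_equiv (nth [::] reps i) (nth [::] reps j) -> i = j) /\
  (forall s, pattern_ss b n s -> exists2 r, r \in reps & rot_equiv r s).

(* Main.v *)
Require Import Defs.
From mathcomp Require Import all_boot all_order all_algebra zify.
Import Order.TTheory GRing.Theory Num.Theory.

(* Reverse time.  A card with right partition v is a vector p <= v, and its left partition is
   obtained by putting the |v| - |p| removed balls in front of p and deleting zeros; hence
   tr (A_b ^ n) counts closed walks of this move on compositions.  A closed walk in which the
   topmost group is never thrown is a closed walk with i < b balls plus a fixed last part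
   b - i, which accounts for the subtracted traces.  Any other closed walk lifts uniquely to a
   periodic sequence of landing states, the same move without deletion of zeros: two lifts
   agree on the entries younger than the elapsed time, and the older entries die out within
   n * b steps.  Differences of consecutive states are exactly the siteswaps of length n with
   b balls.  Moebius inversion over the minimal period and division by the length n of the
   rotation orbits finish the count. *)

(** * Moebius inversion *)

Lemma mobius_mul_prime p e : prime p -> 0 < e -> ~~ (p %| e) ->
  mobius (p * e) = (- mobius e)%R.
Proof.
move=> pp e0 pe; have p0 := prime_gt0 pp.
have pr : perm_eq (primes (p * e)) (p :: primes e).
  apply: uniq_perm; rewrite ?primes_uniq //= ?primes_uniq ?mem_primes ?pp ?e0 ?pe //.
  by move=> q; rewrite primesM // primes_prime // !inE.
rewrite /mobius muln_eq0 !gtn_eqF //= /squarefree (perm_all _ pr) (perm_size pr) /=.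
rewrite lognM // logn_prime // eqxx (_ : logn p e = 0) /=; last first.
  by apply/eqP; rewrite -leqn0 leqNgt logn_gt0 mem_primes pp e0 (negPf pe).
have -> : all (fun q => logn q (p * e) == 1) (primes e) = all (fun q => logn q e == 1) (primes e).
  apply: eq_in_all => q; rewrite mem_primes => /and3P[qp _ qe].
  by rewrite lognM // logn_prime //; case: (eqVneq q p) qe pe => [->->|].
by case: ifP; rewrite ?oppr0 // exprS mulN1r.
Qed.

Lemma mobius_mul_dvd_prime p e : prime p -> 0 < e -> p %| e -> mobius (p * e) = 0%R.
Proof.
move=> pp e0 pe; have p0 := prime_gt0 pp.
rewrite /mobius muln_eq0 !gtn_eqF //=; case: ifP => // /allP /(_ p).
rewrite mem_primes pp muln_gt0 p0 e0 dvdn_mulr // lognM // logn_prime // eqxx => /(_ isT).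
have : 0 < logn p e by rewrite logn_gt0 mem_primes pp e0 pe.
by case: (logn p e).
Qed.

Section RingScope.
Local Open Scope ring_scope.

(* Pairing d with p * d for a prime p dividing n cancels all terms. *)
Lemma sum_mobius n : (0 < n)%N -> \sum_(d <- divisors n) mobius d = (n == 1%N)%:R.
Proof.
move=> n0; case: (ltngtP n 1) => [|n1|->]; first by case: n n0.
  2: by rewrite (_ : divisors 1 = [:: 1%N]) // big_seq1.
have pp := pdiv_prime n1; have p0 := prime_gt0 pp; have pn := pdiv_dvd n.
set p := pdiv n in pp p0 pn.
have np0 : (0 < n %/ p)%N by rewrite divn_gt0 // dvdn_leq.
rewrite (bigID (fun d => p %| d)%N) /=.
have -> : \sum_(d <- divisors n | (p %| d)%N) mobius d =
    \sum_(e <- divisors (n %/ p)) mobius (p * e).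
  rewrite -big_filter -(big_map (muln p) predT mobius); apply: perm_big; apply: uniq_perm.
  - exact/filter_uniq/divisors_uniq.
  - by rewrite map_inj_uniq ?divisors_uniq // => x y /eqP; rewrite eqn_pmul2l // => /eqP.
  move=> d; rewrite mem_filter -dvdn_divisors //; apply/andP/mapP.
    move=> [/dvdnP[e ->] pe]; exists e; last by rewrite mulnC.
    by rewrite -dvdn_divisors // dvdn_divRL // .
  move=> [e]; rewrite -dvdn_divisors // => en ->; split; first exact: dvdn_mulr.
  by rewrite mulnC -dvdn_divRL.
rewrite [X in X + _](bigID (fun d => p %| d)%N) /= [X in X + _ + _]big1_seq ?add0r; last first.
  move=> e /andP[pe]; rewrite -dvdn_divisors // => en.
  by rewrite mobius_mul_dvd_prime // (dvdn_gt0 np0).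
have -> : \sum_(e <- divisors (n %/ p) | ~~ (p %| e)%N) mobius (p * e) =
   - \sum_(e <- divisors n | ~~ (p %| e)%N) mobius e.
  rewrite -sumrN -big_filter -[RHS]big_filter.
  have pe : perm_eq [seq e <- divisors (n %/ p) | ~~ (p %| e)%N]
                    [seq e <- divisors n | ~~ (p %| e)%N].
    apply: uniq_perm; rewrite ?filter_uniq ?divisors_uniq // => d.
    rewrite !mem_filter; case pd: (p %| d)%N => //=; rewrite -!dvdn_divisors //.
    rewrite -{2}(divnK pn) Gauss_dvdl // coprime_sym prime_coprime // pd //.
  rewrite -(perm_big _ pe); apply: eq_big_seq => e.
  rewrite mem_filter -dvdn_divisors // => /andP[pe' en].
  by rewrite mobius_mul_prime // (dvdn_gt0 np0).
by rewrite addNr.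
Qed.

Lemma mobius_inversion (F G : nat -> rat) n : (0 < n)%N ->
  (forall d, (d %| n)%N -> F d = \sum_(e <- divisors d) G e) ->
  G n = \sum_(d <- divisors n) (mobius (n %/ d))%:~R * F d.
Proof.
move=> n0 FG.
have sumE m (E : nat -> rat) : (m %| n)%N ->
    \sum_(e <- divisors m) E e = \sum_(e < n.+1 | (e %| m)%N) E e.
  move=> mn; have m0 := dvdn_gt0 n0 mn.
  rewrite -(big_mkord (fun e => e %| m)%N) -[RHS]big_filter; apply: perm_big.
  apply: uniq_perm; rewrite ?divisors_uniq ?filter_uniq ?iota_uniq // => e.
  rewrite -dvdn_divisors // mem_filter mem_index_iota /= ltnS andbC.
  by case em: (e %| m)%N; rewrite ?andbF // andbT (dvdn_leq n0 (dvdn_trans em mn)).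
rewrite sumE //; transitivity (\sum_(e < n.+1 | (e %| n)%N)
   \sum_(d < n.+1 | (d %| n)%N && (e %| d)%N) (mobius (n %/ d))%:~R * G e).
  rewrite (bigD1 ord_max) //= [X in _ = _ + X]big1 ?addr0.
    rewrite (big_pred1 ord_max) /= ?divnn ?n0 ?mul1r // => d.
    by rewrite -eqn_dvd.
  move=> e /andP[en ne]; rewrite -big_distrl /= -[X in X * _]rmorph_sum /=.
  have e0 : (0 < e)%N := dvdn_gt0 n0 en.
  have ne0 : (0 < n %/ e)%N by rewrite divn_gt0 // dvdn_leq.
  suff -> : \sum_(d < n.+1 | (d %| n)%N && (e %| d)%N) mobius (n %/ d) = 0 by rewrite mul0r.
  transitivity ((n %/ e == 1)%N%:R : int); last first.
    case: eqP => // ne1; case/eqP: ne; apply: val_inj => /=.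
    by have := divnK en; rewrite ne1 mul1n.
  rewrite -sum_mobius // -(big_mkord (fun d => (d %| n) && (e %| d))%N (fun d => mobius (n %/ d))).
  rewrite -big_filter -(big_map (divn n) predT mobius); apply: perm_big.
  have divdK d : (d %| n)%N -> (n %/ (n %/ d))%N = d.
    move=> dn; have d0 := dvdn_gt0 n0 dn.
    have q0 : (0 < n %/ d)%N by rewrite divn_gt0 // dvdn_leq.
    by apply/eqP; rewrite eq_sym eqn_div ?dvdn_div // mulnC divnK.
  apply: uniq_perm; rewrite ?divisors_uniq //.
    rewrite map_inj_in_uniq ?filter_uniq ?iota_uniq // => x y.
    rewrite !mem_filter => /andP[/andP[xn _] _] /andP[/andP[yn _] _] exy.
    by rewrite -(divdK x) // exy divdK.
  move=> k; rewrite -dvdn_divisors //; apply/mapP/idP.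
    move=> [d]; rewrite mem_filter => /andP[/andP[dn ed] _] ->.
    by rewrite dvdn_divRL ?(dvdn_trans ed) // -[X in (_ %| X)%N](divnK dn) dvdn_mul.
  move=> kn; have kn' : (k %| n)%N by apply: dvdn_trans kn (dvdn_div en).
  exists (n %/ k)%N; last by rewrite divdK.
  rewrite mem_filter mem_index_iota /= ltnS leq_div andbT dvdn_div // dvdn_divRL //.
  by rewrite mulnC -dvdn_divRL.
rewrite (exchange_big_dep (fun d : 'I_n.+1 => d %| n)%N) /=; last by move=> e d _ /andP[].
apply: eq_bigr => d dn; rewrite FG // sumE // big_distrr /=.
apply: eq_bigl => e; rewrite dn /=; case ed: (e %| d)%N; rewrite ?andbF ?andbT //.
exact: dvdn_trans ed dn.
Qed.

End RingScope.

(** * Cards and traces *)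

Definition nz (p : seq nat) : seq nat := [seq x <- p | 0 < x].

Fixpoint subs (v : seq nat) : seq (seq nat) :=
  if v is a :: v' then [seq x :: p | x <- iota 0 a.+1, p <- subs v'] else [:: [::]].

(* A card with right partition v is a vector p <= v recording how many of the balls of each
   group of v were already in the air: the trivial card is p = v, the left partition is
   step v p. *)
Definition step (v p : seq nat) : seq nat := nz (sumn v - sumn p :: p).

Fixpoint walks (n : nat) (v : seq nat) : seq (seq (seq nat)) :=
  if n is n'.+1 then [seq p :: ps | p <- subs v, ps <- walks n' (step v p)]
  else [:: [::]].

Definition closed_walks (b n : nat) : seq (seq nat * seq (seq nat)) :=
  [seq w <- [seq (v, ps) | v <- comps b, ps <- walks n v] | foldl step w.1 w.2 == w.1].

Lemma sumn_nz p : sumn (nz p) = sumn p.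
Proof. by elim: p => //= -[|x] p <-. Qed.

Lemma nz_id p : all (fun x => 0 < x) p -> nz p = p.
Proof. by move/all_filterP. Qed.

Lemma all_nz p : all (fun x => 0 < x) (nz p).
Proof. exact: filter_all. Qed.

Lemma mem_subs v p : (p \in subs v) = all2 leq p v.
Proof.
elim: v p => [|a v IH] p; first by case: p.
apply/allpairsP/idP => [[[y q] /= [ya qv ->]]|].
  by rewrite /= -IH qv andbT; move: ya; rewrite -[0 :: _]/(iota 0 a.+1) mem_iota.
case: p => //= x p /andP[xa pv]; exists (x, p); rewrite IH; split=> //.
by rewrite -[0 :: _]/(iota 0 a.+1) mem_iota.
Qed.

Lemma uniq_subs v : uniq (subs v).
Proof.
elim: v => // a v IH; apply: allpairs_uniq => //; first exact: iota_uniq.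
by move=> [? ?] [? ?] _ _ [-> ->].
Qed.

Lemma all2_leq_sumn p v : all2 leq p v -> sumn p <= sumn v.
Proof.
by elim: p v => [|x p IH] [|a v] //= /andP[xa /IH pv]; rewrite leq_add.
Qed.

Lemma all2_leq_eq p v : all2 leq p v -> sumn v <= sumn p -> p = v.
Proof.
elim: p v => [|x p IH] [|a v] //= /andP[xa pv] le.
by have := all2_leq_sumn _ _ pv => le'; rewrite (IH v) //; [congr (_ :: _)|]; lia.
Qed.

Lemma all2_leq_nth p v i : all2 leq p v -> nth 0 p i <= nth 0 v i.
Proof. by elim: p v i => [|x p IH] [|a v] [|i] //= /andP[xa pv] //; apply: IH. Qed.

Lemma all2_leqP p v :
  size p = size v -> (forall i, i < size v -> nth 0 p i <= nth 0 v i) -> all2 leq p v.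
Proof.
elim: p v => [|x p IH] [|a v] //= [sz] le; rewrite (le 0) //= IH // => i iv.
exact: (le i.+1).
Qed.

Lemma size_all2_leq p v : all2 leq p v -> size p = size v.
Proof. by rewrite all2E => /andP[/eqP]. Qed.

Lemma mem_words l m w : (w \in words l m) = (size w == l) && all (fun x => 0 < x <= m) w.
Proof.
elim: l w => [|l IH] [|x w] //=; first by apply/allpairsP => -[[? ?] []].
apply/allpairsP/idP.
  by move=> [[y q] /= [+ qv [-> ->]]]; rewrite mem_iota add1n ltnS eqSS => ->; rewrite -IH.
rewrite eqSS => /and3P[sz xm wm]; exists (x, w); split=> //=; last by rewrite IH sz.
by rewrite mem_iota add1n ltnS.
Qed.

Lemma uniq_words l m : uniq (words l m).
Proof.
elim: l => // l IH; apply: allpairs_uniq => //; first exact: iota_uniq.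
by move=> [? ?] [? ?] _ _ [-> ->].
Qed.

Lemma mem_comps b q : (q \in comps b) = is_composition b q.
Proof.
rewrite mem_filter andb_idr // => /andP[pos /eqP sq]; apply/flatten_mapP.
have sz : size q <= b.
  by rewrite -sq; elim: q pos {sq} => //= x q IH /andP[x0 /IH]; lia.
exists (size q); first by rewrite mem_iota.
rewrite mem_words eqxx /=; apply/allP => x xq; rewrite (allP pos x xq) -sq /=.
by elim: q xq {pos sq sz} => //= y q IH; rewrite inE => /orP[/eqP->|/IH]; lia.
Qed.

Lemma uniq_comps b : uniq (comps b).
Proof.
apply: filter_uniq; elim: (iota 0 b.+1) (iota_uniq 0 b.+1) => //= l ls IH /andP[nl /IH uls].
rewrite cat_uniq uniq_words uls andbT /=; apply/hasPn => w /flatten_mapP[l' l'ls].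
rewrite mem_words => /andP[/eqP sz _]; rewrite mem_words sz.
by case: eqP l'ls nl => // -> ->.
Qed.

Lemma is_comp_step b v p :
  is_composition b v -> all2 leq p v -> is_composition b (step v p).
Proof.
move=> /andP[_ /eqP <-] pv; rewrite /is_composition all_nz sumn_nz /= subnK //.
exact: all2_leq_sumn.
Qed.

Lemma step_id v : all (fun x => 0 < x) v -> step v v = v.
Proof. by move=> pos; rewrite /step subnn; exact: (nz_id v). Qed.

Lemma card_embeddings (q v : seq nat) : all (fun x => 0 < x) q ->
  #|[set t : (size q).-tuple 'I_(size v) |
      sorted ltn (map val t) && all2 (fun x (i : 'I_(size v)) => x <= nth 0 v i) q t]|
  = count (fun p => nz p == q) (subs v).
Proof.
move=> pos; set A := [set _ | _].
pose f (t : (size q).-tuple 'I_(size v)) :=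
  mkseq (fun i => if i \in map val t then nth 0 q (index i (map val t)) else 0) (size v).
have supp t : t \in A -> [seq i <- iota 0 (size v) | 0 < nth 0 (f t) i] = map val t.
  rewrite inE => /andP[st _]; apply: (irr_sorted_eq ltn_trans ltnn) => //.
    exact/(sorted_filter ltn_trans)/iota_ltn_sorted.
  move=> i; rewrite mem_filter mem_iota add0n /=.
  have [iv|vi] := ltnP i (size v); last first.
    rewrite andbF; apply/esym/negbTE/mapP => -[j _ ij].
    by rewrite ij in vi; have := leq_trans (ltn_ord j) vi; rewrite ltnn.
  rewrite andbT nth_mkseq //; case: ifP => // it.
  by apply: (all_nthP 0 pos); rewrite -[X in _ < X](size_tuple t) -(size_map val) index_mem.
have nzf t : t \in A -> nz (f t) = q.
  move=> tA; rewrite /nz -{1}[f t](mkseq_nth 0) size_mkseq /mkseq filter_map.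
  rewrite (eq_filter (a2 := fun i => 0 < nth 0 (f t) i)) // supp //.
  apply: (@eq_from_nth _ 0) => [|i]; rewrite !size_map ?size_tuple // => iq.
  have iq' : i < size (map val t) by rewrite size_map size_tuple.
  move: tA; rewrite inE => /andP[st _].
  rewrite (nth_map 0) // nth_mkseq; last first.
    rewrite (nth_map (tnth t (Ordinal iq))) ?size_tuple //; exact: ltn_ord.
  rewrite mem_nth // index_uniq //; exact: (sorted_uniq ltn_trans ltnn).
rewrite -size_filter cardE -(size_map f); apply: perm_size; apply: uniq_perm.
- rewrite map_inj_in_uniq ?enum_uniq // => t t'; rewrite !mem_enum => tA tA' ff.
  by apply/val_inj/(inj_map val_inj); rewrite -[LHS]supp // -[RHS]supp // ff.
- exact/filter_uniq/uniq_subs.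
move=> p; rewrite mem_filter mem_subs; apply/mapP/andP.
  move=> [t]; rewrite mem_enum => tA ->; rewrite nzf // eqxx; split=> //.
  apply: all2_leqP => [|i iv]; rewrite ?size_mkseq // nth_mkseq //; case: ifP => // it.
  move: tA; rewrite inE => /andP[st]; rewrite all2E => /andP[_ /(all_nthP (0, Ordinal iv))].
  move=> /(_ (index i (map val t))); rewrite size_zip size_tuple minnn.
  have lt : index i (map val t) < size q.
    by rewrite -[X in _ < X](size_tuple t) -(size_map val) index_mem.
  move=> /(_ lt); rewrite nth_zip ?size_tuple //=.
  suff -> : nat_of_ord (nth (Ordinal iv) t (index i (map val t))) = i by [].
  by rewrite -[LHS](nth_map _ 0 val) ?size_tuple // nth_index.
move=> [/eqP nzp pv]; have szp := size_all2_leq _ _ pv.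
pose l := [seq i : 'I_(size v) <- enum 'I_(size v) | 0 < nth 0 p i].
have lE : map val l = [seq i <- iota 0 (size v) | 0 < nth 0 p i].
  by rewrite -val_enum_ord filter_map.
have nzE : q = [seq nth 0 p i | i <- map val l].
  by rewrite lE -nzp /nz -{1}[p](mkseq_nth 0) /mkseq filter_map szp.
have szl : size l == size q by rewrite nzE !size_map.
have sl : sorted ltn (map val l).
  by rewrite lE; apply/(sorted_filter ltn_trans)/iota_ltn_sorted.
exists (Tuple szl).
  rewrite mem_enum inE /= sl /= nzE -map_comp.
  elim: (l : seq _) => //= i l' ->; rewrite andbT; exact: all2_leq_nth.
apply: (@eq_from_nth _ 0) => [|i]; rewrite ?size_mkseq // szp => iv.
rewrite nth_mkseq //=; case: ifP => il.
  by rewrite nzE (nth_map 0) ?index_mem // nth_index.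
by move: il; rewrite lE mem_filter mem_iota add0n iv /= andbT lt0n => /negbFE/eqP->.
Qed.

Lemma num_cardsE b u v : is_composition b u -> is_composition b v ->
  num_cards u v = count (fun p => step v p == u) (subs v).
Proof.
move=> /andP[upos /eqP ub] /andP[vpos /eqP vb]; rewrite /num_cards.
case: u upos ub => [|a u] upos ub /=.
  rewrite addn0; move: vb; rewrite -ub /= => v0.
  have -> : v = [::] by case: v vpos {v0} (v0) => //= x v /andP[]; lia.
  by [].
have a0 : 0 < a by case/andP: upos.
rewrite card_embeddings; last by case/andP: upos.
have -> : (a :: u == v) + count (fun p => nz p == u) (subs v) =
    count (fun p => (p == v) && (a :: u == v)) (subs v) + count (fun p => nz p == u) (subs v).
  congr (_ + _); case: eqP => _; last first.
    by rewrite (eq_count (a2 := pred0)) ?count_pred0 // => p; rewrite andbF.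
  rewrite (eq_count (a2 := pred1 v)) => [|p]; last by rewrite andbT.
  by rewrite count_uniq_mem ?uniq_subs // mem_subs all2_leqP.
rewrite -count_predUI [X in _ + X](eq_in_count (a2 := pred0)) ?count_pred0 ?addn0; last first.
  move=> p; rewrite mem_subs => pv /=; apply/negbTE/negP => /andP[/andP[/eqP-> _] /eqP e].
  by move: vb; rewrite -(sumn_nz v) e -ub /=; lia.
apply: eq_in_count => p; rewrite mem_subs => pv /=.
have [->|npv] := eqVneq p v.
  rewrite step_id // eq_sym /= orb_idr // => /eqP e.
  by move: vb; rewrite -(sumn_nz v) e -ub /=; lia.
rewrite /step /= ifT; last first.
  rewrite subn_gt0 ltnNge; apply/negP => /(all2_leq_eq _ _ pv) e.
  by rewrite e eqxx in npv.
rewrite eqseq_cons; case: (nz p =P u) => [e|]; rewrite ?andbF // andbT.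
by apply/esym/eqP; rewrite -(sumn_nz p) e vb -ub /= addnK.
Qed.

Lemma walksP n v ps : reflect
  (size ps = n /\ forall k, k < n -> all2 leq (nth [::] ps k) (foldl step v (take k ps)))
  (ps \in walks n v).
Proof.
elim: n v ps => [|n IH] v ps /=.
  by apply: (iffP idP) => [|[/size0nil->]] //; rewrite inE => /eqP ->.
apply: (iffP allpairsPdep) => [[p [ps' [pv /IH[sz H] ->]]]|[]].
  by split=> [|[|k] kn] /=; [rewrite sz | rewrite -mem_subs | apply: H].
case: ps => // p ps [sz] H; exists p, ps; split=> //.
  by have := H 0 isT; rewrite mem_subs take0.
by apply/IH; split=> // k kn; apply: (H k.+1).
Qed.

Lemma uniq_walks n v : uniq (walks n v).
Proof.
elim: n v => // n IH v /=; apply: allpairs_uniq_dep; first exact: uniq_subs.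
  by move=> p _; apply: IH.
by move=> [p ps] [p' ps'] _ _ /= [-> ->].
Qed.

Lemma uniq_closed_walks b n : uniq (closed_walks b n).
Proof.
apply: filter_uniq; apply: allpairs_uniq_dep; first exact: uniq_comps.
  by move=> p _; apply: uniq_walks.
by move=> [p ps] [p' ps'] _ _ /= [-> ->].
Qed.

Lemma mem_closed_walks b n v ps : ((v, ps) \in closed_walks b n) =
  [&& foldl step v ps == v, is_composition b v & ps \in walks n v].
Proof.
rewrite mem_filter /=; congr andb; rewrite -mem_comps; apply/allpairsPdep/andP.
  by move=> [v' [ps' [v'b ps'v [-> ->]]]].
by move=> [vb psv]; exists v, ps.
Qed.

Lemma Amx_exp b n i j :
  (Amx b ^+ n)%R i j = Posz (count (fun ps => foldl step (nth [::] (comps b) j) ps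
    == nth [::] (comps b) i) (walks n (nth [::] (comps b) j))).
Proof.
have compP (k : 'I_(size (comps b))) : is_composition b (nth [::] (comps b) k).
  by rewrite -mem_comps mem_nth.
elim: n j => [|n IH] j /=.
  rewrite expr0 addn0 -[1%R]/(1%:M)%R mxE /=.
  rewrite nth_uniq ?uniq_comps // (_ : (i == j) = (nat_of_ord j == i)); last by rewrite eq_sym.
  by case: eqP.
rewrite exprSr -[(_ * _)%R]/(_ *m _)%R mxE.
under eq_bigr => k _ do rewrite IH mxE (num_cardsE _ _ _ (compP k) (compP j)) -PoszM.
rewrite -(big_morph Posz PoszD (erefl _)); congr Posz.
set v := nth [::] (comps b) j; set w := nth [::] (comps b) i.
rewrite count_flatten sumnE !big_map.
under eq_bigr => k _ do rewrite -[X in _ * X]sum1_count big_distrr big_mkcond /=.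
rewrite exchange_big /=; apply: eq_big_seq => p; rewrite mem_subs => pv.
have sc : step v p \in comps b by rewrite mem_comps is_comp_step // compP.
have ks : index (step v p) (comps b) < size (comps b) by rewrite index_mem.
rewrite (bigD1 (Ordinal ks)) //= nth_index // eqxx muln1 big1 ?addn0 ?count_map //.
move=> k nk; case: eqP => // e; case/eqP: nk; apply: val_inj => /=.
by rewrite e index_uniq ?uniq_comps.
Qed.

Lemma tr_Amx_exp b n : (\tr (Amx b ^+ n))%R = Posz (size (closed_walks b n)).
Proof.
rewrite /mxtrace; under eq_bigr => i _ do rewrite Amx_exp.
rewrite -(big_morph Posz PoszD (erefl _)); congr Posz.
rewrite [RHS]size_filter count_flatten sumnE !big_map (big_nth [::]) big_mkord.
by apply: eq_bigr => i _; rewrite count_map.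
Qed.

(** * Closed walks *)

Definition periodic_walk (b n : nat) (R P : nat -> seq nat) : Prop :=
  [/\ forall t, is_composition b (R t), forall t, all2 leq (P t) (R t),
      forall t, R t.+1 = step (R t) (P t),
      forall t, R (t + n) = R t & forall t, P (t + n) = P t].

Lemma periodic_mul T (f : nat -> T) n k t : (forall t, f (t + n) = f t) -> f (t + n * k) = f t.
Proof. by move=> per; elim: k => [|k IH]; rewrite ?muln0 ?addn0 // mulnS addnCA addnC per. Qed.

Lemma periodic_mod T (f : nat -> T) n t : (forall t, f (t + n) = f t) -> f (t %% n) = f t.
Proof. by move=> per; rewrite {2}(divn_eq t n) addnC mulnC (periodic_mul _ f). Qed.

Lemma foldl_periodic_walk b n R P k : periodic_walk b n R P ->
  foldl step (R 0) (mkseq P k) = R k.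
Proof. by move=> [_ _ RS _ _]; elim: k => // k IH; rewrite mkseqS -cats1 foldl_cat /= IH RS. Qed.

Lemma take_mkseq T (f : nat -> T) k n : k <= n -> take k (mkseq f n) = mkseq f k.
Proof. by move=> kn; rewrite -map_take take_iota (minn_idPl kn). Qed.

Lemma closed_walksP b n w : 0 < n ->
  w \in closed_walks b n <-> exists R P, periodic_walk b n R P /\ w = (R 0, mkseq P n).
Proof.
move=> n0; split; last first.
  move=> [R [P [wk ->]]]; rewrite mem_closed_walks (foldl_periodic_walk _ _ _ _ _ wk).
  case: (wk) => Rc PR _ Rn _; rewrite -{1}[n]add0n Rn eqxx Rc /=.
  apply/walksP; rewrite size_mkseq; split=> // k kn.
  by rewrite take_mkseq 1?ltnW // (foldl_periodic_walk _ _ _ _ _ wk) nth_mkseq.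
case: w => v ps; rewrite mem_closed_walks => /and3P[/eqP cl vc /walksP[sz H]].
pose P t := nth [::] ps (t %% n); pose R t := foldl step v (mkseq P t).
have mkE k : k <= n -> mkseq P k = take k ps.
  move=> kn; apply: (@eq_from_nth _ [::]); rewrite size_mkseq ?size_takel ?sz //.
  by move=> i ik; rewrite nth_mkseq // nth_take // /P modn_small // (leq_trans ik).
have Pn t : P (t + n) = P t by rewrite /P modnDr.
have RS t : R t.+1 = step (R t) (P t) by rewrite /R mkseqS -cats1 foldl_cat.
have Rn t : R (t + n) = R t.
  elim: t => [|t IH]; last by rewrite addSn !RS IH Pn.
  by rewrite add0n /R mkE // -sz take_size cl.
have PR t : all2 leq (P t) (R t).
  rewrite -(periodic_mod _ R n) // -(periodic_mod _ P n) //.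
  have tn : t %% n < n by rewrite ltn_mod.
  by rewrite /R mkE 1?ltnW // /P modn_small //; apply: H.
exists R, P; split; last by rewrite mkE // -sz take_size.
by split=> //; elim=> [|t IH] //; rewrite RS; apply: is_comp_step.
Qed.

(* In a bad walk the topmost group of balls is never thrown. *)
Definition bad_walk (w : seq nat * seq (seq nat)) : bool :=
  all (fun p => (p != [::]) && (last 0 p == last 0 w.1)) w.2.

Definition raise (k : nat) (w : seq nat * seq (seq nat)) : seq nat * seq (seq nat) :=
  (rcons w.1 k, [seq rcons p k | p <- w.2]).

Lemma raise_inj k : injective (raise k).
Proof.
move=> [v ps] [v' ps'] [/rcons_inj[->] e]; congr pair.
by apply: inj_map e => p p' /rcons_inj[].
Qed.

Lemma step_rcons v p k : 0 < k -> step (rcons v k) (rcons p k) = rcons (step v p) k.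
Proof.
move=> k0; rewrite /step !sumn_rcons subnDr /= /nz -cats1 filter_cat /= k0 cats1.
by case: ifP.
Qed.

Lemma all2_leq_rcons p v k k' :
  all2 leq (rcons p k) (rcons v k') = all2 leq p v && (k <= k').
Proof.
elim: p v => [|x p IH] [|y v] //=; rewrite ?andbT ?andbF //; try by rewrite IH andbA.
- by case: v; rewrite /= andbF.
- by case: p {IH}; rewrite /= andbF.
Qed.

Lemma foldl_step_raise v ps k : 0 < k ->
  foldl step (rcons v k) [seq rcons p k | p <- ps] = rcons (foldl step v ps) k.
Proof. by move=> k0; elim: ps v => //= p ps IH v; rewrite step_rcons. Qed.

Lemma is_comp_rcons b k v : 0 < k <= b ->
  is_composition b (rcons v k) = is_composition (b - k) v.
Proof.
move=> /andP[k0 kb]; rewrite /is_composition all_rcons sumn_rcons k0 /=; congr andb; lia.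
Qed.

Lemma raise_closed_walk b n k w : 0 < k <= b ->
  (raise k w \in closed_walks b n) = (w \in closed_walks (b - k) n).
Proof.
move=> kb; have k0 : 0 < k by case/andP: kb.
case: w => v ps; rewrite !mem_closed_walks foldl_step_raise // eqseq_rcons eqxx andbT.
rewrite is_comp_rcons //; congr [&& _, _ & _]; apply/walksP/walksP => -[sz H].
  rewrite size_map in sz; split=> // i iN; move: (H i iN).
  by rewrite (nth_map [::]) ?sz // -map_take foldl_step_raise // all2_leq_rcons leqnn andbT.
rewrite size_map; split=> // i iN; move: (H i iN).
by rewrite (nth_map [::]) ?sz // -map_take foldl_step_raise // all2_leq_rcons leqnn andbT.
Qed.

Lemma size_bad_walks b n : 0 < n ->
  count bad_walk (closed_walks b n) = \sum_(i < b) size (closed_walks i n).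
Proof.
move=> n0; pose L := [seq (i, w) | i <- iota 0 b, w <- closed_walks i n].
have -> : \sum_(i < b) size (closed_walks i n) = size L.
  rewrite size_allpairs_dep sumnE big_map.
  by rewrite -(big_mkord xpredT (fun i => size (closed_walks i n))) /index_iota subn0.
have uL : uniq L.
  apply: allpairs_uniq_dep => [|i _|[i w] [i' w'] _ _ /= [-> ->]] //.
    exact: iota_uniq.
  exact: uniq_closed_walks.
pose f (x : nat * (seq nat * seq (seq nat))) := raise (b - x.1) x.2.
rewrite -size_filter -(size_map f L); apply/perm_size/uniq_perm.
- exact/filter_uniq/uniq_closed_walks.
- rewrite map_inj_in_uniq // => x x'.
  move=> /allpairsPdep[i [w [ib _ ->]]] /allpairsPdep[i' [w' [ib' _ ->]]] e.
  have ei : i = i'.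
    have := congr1 (fun w => last 0 w.1) e; rewrite /f /= !last_rcons.
    by move: ib ib'; rewrite !mem_iota; lia.
  by rewrite -ei in e *; congr pair; apply: raise_inj e.
move=> w; rewrite mem_filter; apply/andP/mapP.
  case: w => v ps [/allP bad vps]; move: (vps); rewrite mem_closed_walks.
  move=> /and3P[/eqP cl vc /walksP[sz H]].
  have [p0 ps0] : exists p, p \in ps by exists (nth [::] ps 0); rewrite mem_nth ?sz.
  have vnil : v != [::].
    have := H 0 n0; rewrite take0 /= => /size_all2_leq.
    by case: {+}v (nth _ _ _) (bad _ (mem_nth [::] (etrans (congr1 _ sz) n0))) => //= -[].
  case/lastP: v vnil vps vc bad {cl H} => // v k _ vps vc bad.
  have kb : 0 < k <= b.
    by case/andP: vc; rewrite all_rcons sumn_rcons => /andP[-> _] /eqP <-; rewrite leq_addl.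
  pose ps' := [seq take (size p).-1 p | p <- ps].
  have wE : (rcons v k, ps) = raise k (v, ps').
    congr pair; rewrite -map_comp -[LHS]map_id; apply/eq_in_map => p pps /=.
    have := bad p pps; rewrite last_rcons; case/lastP: p {pps} => // p x /= /andP[_ /eqP].
    by rewrite last_rcons size_rcons /= -cats1 take_size_cat // cats1 => ->.
  exists (b - k, (v, ps')); last by rewrite /f /= subKn //; case/andP: kb.
  apply/allpairsPdep; exists (b - k), (v, ps'); split=> //.
    by rewrite mem_iota; lia.
  by rewrite -raise_closed_walk // -wE.
move=> [x /allpairsPdep[i [w' [ib wi ->]]] ->]; rewrite mem_iota /= in ib.
rewrite add0n in ib; split; last first.
  have bi : 0 < b - i <= b by rewrite subn_gt0 ib leq_subr.
  by rewrite /f /= raise_closed_walk // subKn // ltnW.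
rewrite /f /bad_walk /= all_map; apply/allP => p _ /=.
by rewrite !last_rcons eqxx andbT; case: p.
Qed.

(** * Landing states *)

Definition rank (x : nat -> nat) (i : nat) : nat := count (fun j => 0 < x j) (iota 0 i).

(* x is a vector whose nonzero entries are a composition v; lift b x p is step v p with the
   zeros of x (the empty landing times) kept. *)
Definition lift (b : nat) (x : nat -> nat) (p : seq nat) (i : nat) : nat :=
  if i is i'.+1 then if 0 < x i' then nth 0 p (rank x i') else 0 else b - sumn p.

Lemma rankS x i : rank x i.+1 = rank x i + (0 < x i).
Proof. by rewrite /rank -[i.+1]addn1 iotaD count_cat /= addn0. Qed.

Lemma map_rank x H : [seq rank x i | i <- iota 0 H & 0 < x i] = iota 0 (rank x H).
Proof.
elim: H => // H IH; rewrite rankS -[H.+1]addn1 iotaD filter_cat map_cat IH /= iotaD.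
by case: ifP.
Qed.

Lemma nz_mkseq x H : nz (mkseq x H) = [seq x i | i <- iota 0 H & 0 < x i].
Proof. by rewrite /nz /mkseq filter_map. Qed.

Lemma size_nz_mkseq x H : size (nz (mkseq x H)) = rank x H.
Proof. by rewrite nz_mkseq size_map size_filter. Qed.

Lemma nth_nz_rank x H i : i < H -> 0 < x i -> nth 0 (nz (mkseq x H)) (rank x i) = x i.
Proof.
move=> iH xi; rewrite nz_mkseq -(subnKC iH) iotaD filter_cat map_cat -[i.+1]addn1 iotaD filter_cat.
rewrite map_cat /= xi nth_cat size_cat !size_map size_filter -/(rank x i) /= addn1 leqnn.
by rewrite nth_cat size_map size_filter ltnn subnn.
Qed.

Lemma nz_mkseq_support x (g : nat -> nat) H : (forall i, x i = 0 -> g i = 0) ->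
  nz (mkseq g H) = nz [seq g i | i <- iota 0 H & 0 < x i].
Proof.
move=> gx; rewrite nz_mkseq [in RHS]/nz filter_map -filter_predI; congr map.
apply: eq_filter => i /=; have := gx i; case: (x i) => [-> //|m _]; by rewrite andbT.
Qed.

Lemma map_lift b x p H : size p = rank x H ->
  [seq lift b x p i.+1 | i <- iota 0 H & 0 < x i] = p.
Proof.
move=> sz; rewrite -[RHS](mkseq_nth 0) /mkseq sz -map_rank -map_comp; apply/eq_in_map => i.
by rewrite mem_filter /= => /andP[-> _].
Qed.

Lemma nz_lift b x p H : sumn (nz (mkseq x H)) = b -> all2 leq p (nz (mkseq x H)) ->
  nz (mkseq (lift b x p) H.+1) = step (nz (mkseq x H)) p.
Proof.
move=> sb pv; have sz : size p = rank x H by rewrite (size_all2_leq _ _ pv) size_nz_mkseq.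
have -> : mkseq (lift b x p) H.+1 = b - sumn p :: mkseq (fun i => lift b x p i.+1) H.
  by rewrite /mkseq /= -[1]addn0 iotaDl -map_comp.
rewrite /step sb /nz /= -!/(nz _) (nz_mkseq_support x) ?map_lift //.
by move=> i /= ->.
Qed.

Lemma lift_le b x p H i : (forall j, H <= j -> x j = 0) ->
  all2 leq p (nz (mkseq x H)) -> lift b x p i.+1 <= x i.
Proof.
move=> x0 pv /=; case: ifP => // xi.
have iH : i < H by rewrite ltnNge; apply/negP => /x0 e; rewrite e in xi.
by rewrite -[X in _ <= X](nth_nz_rank x H) //; apply: all2_leq_nth.
Qed.

Lemma eq_lift b x x' p k : (forall i, i < k -> x i = x' i) ->
  forall i, i < k.+1 -> lift b x p i = lift b x' p i.
Proof.
move=> e [|i] //=; rewrite ltnS => ik; rewrite e // /rank.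
rewrite (eq_in_count (a2 := fun j => 0 < x' j)) // => j.
by rewrite mem_iota => /andP[_ ji]; rewrite e //; apply: ltn_trans ik.
Qed.

Lemma sumn_mkseq x H : sumn (mkseq x H) = \sum_(i < H) x i.
Proof. by rewrite sumnE big_map -(big_mkord xpredT) /index_iota subn0. Qed.

Lemma filter_iota_last x l H : l < H -> 0 < x l -> (forall j, l < j -> x j = 0) ->
  [seq i <- iota 0 H | 0 < x i] = rcons [seq i <- iota 0 l | 0 < x i] l.
Proof.
move=> lH xl x0; rewrite -(subnKC lH) iotaD filter_cat -[l.+1]addn1 iotaD filter_cat /= xl cats1.
rewrite [X in _ ++ X](eq_in_filter (a2 := pred0)) ?filter_pred0 ?cats0 // => j.
by rewrite mem_iota addn1 => /andP[lj _]; rewrite x0.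
Qed.

Lemma filter_support x H K : (forall i, H <= i -> x i = 0) -> (forall i, K <= i -> x i = 0) ->
  [seq i <- iota 0 H | 0 < x i] = [seq i <- iota 0 K | 0 < x i].
Proof.
have widen H' L : (forall i, H' <= i -> x i = 0) ->
    [seq i <- iota 0 (H' + L) | 0 < x i] = [seq i <- iota 0 H' | 0 < x i].
  move=> x0; rewrite iotaD filter_cat (eq_in_filter (s := iota _ L) (a2 := pred0)).
    by rewrite filter_pred0 cats0.
  by move=> j; rewrite mem_iota => /andP[Hj _]; rewrite x0.
by move=> xH xK; rewrite -(widen H K) // -(widen K H) // addnC.
Qed.

(* X t i is the number of balls in the air at time - t that land i steps later. *)
Definition state (H b n : nat) (X : nat -> nat -> nat) : Prop :=
  [/\ forall t i, H <= i -> X t i = 0, forall t, \sum_(i < H) X t i = b,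
      forall t i, X t.+1 i.+1 <= X t i & forall t i, X (t + n) i = X t i].

Definition parts (H : nat) (X : nat -> nat -> nat) (t : nat) : seq nat := nz (mkseq (X t) H).

Definition airborne (H : nat) (X : nat -> nat -> nat) (t : nat) : seq nat :=
  [seq X t.+1 i.+1 | i <- iota 0 H & 0 < X t i].

Lemma state_walk H b n X : state H b n X -> periodic_walk b n (parts H X) (airborne H X).
Proof.
move=> [X0 Xb XS Xn]; have sumX t : sumn (parts H X t) = b by rewrite sumn_nz sumn_mkseq.
have sumXH t : \sum_(i < H.+1) X t i = b by rewrite big_ord_recr /= X0 // addn0.
have nzA t : nz (airborne H X t) = nz (mkseq (fun i => X t.+1 i.+1) H).
  rewrite (nz_mkseq_support (X t)) // => i Xi; apply/eqP.
  by rewrite -leqn0 -Xi XS.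
split=> [t|t|t|t|t].
- by rewrite /is_composition all_nz sumX eqxx.
- rewrite /parts nz_mkseq /airborne; elim: [seq _ <- _ | _] => //= i s ->.
  by rewrite XS.
- rewrite /step sumX /nz /= -!/(nz _) nzA.
  have -> : b - sumn (airborne H X t) = X t.+1 0.
    rewrite -sumn_nz nzA sumn_nz sumn_mkseq -(sumXH t.+1) big_ord_recl /=.
    by rewrite addnK.
  have -> : parts H X t.+1 = nz (mkseq (X t.+1) H.+1).
    by rewrite /parts mkseqS /nz filter_rcons X0.
  by rewrite /mkseq /= -[1]addn0 iotaDl -map_comp.
- by rewrite /parts; congr nz; apply: eq_map => i.
- rewrite /airborne (eq_filter (a2 := fun i => 0 < X t i)) => [|i]; last by rewrite Xn.
  by apply: eq_map => i; rewrite -addSn Xn.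
Qed.

Lemma state_lift H b n X t i : state H b n X ->
  X t.+1 i = lift b (X t) (airborne H X t) i.
Proof.
move=> [X0 Xb XS Xn].
have sumXH : \sum_(i < H.+1) X t.+1 i = b by rewrite big_ord_recr /= X0 // addn0.
case: i => [|i] /=.
  have sup i : X t i = 0 -> X t.+1 i.+1 = 0 by move=> Xi; apply/eqP; rewrite -leqn0 -Xi XS.
  have /(congr1 sumn) := nz_mkseq_support _ _ H sup.
  rewrite !sumn_nz sumn_mkseq -/(airborne H X t) => <-.
  by rewrite -sumXH big_ord_recl /= addnK.
case: ifP => Xi; last first.
  by apply/eqP; rewrite -leqn0; move/negbT: Xi; rewrite -leqNgt; apply: leq_trans.
have iH : i < H by rewrite ltnNge; apply/negP => /(X0 t) e; rewrite e in Xi.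
rewrite /airborne -(subnKC iH) iotaD filter_cat map_cat -[i.+1]addn1 iotaD filter_cat.
rewrite map_cat /= Xi nth_cat size_cat !size_map size_filter -/(rank (X t) i) /= !addn1 leqnn.
by rewrite nth_cat size_map size_filter ltnn subnn.
Qed.

Lemma last_airborne H X t l : l < H -> 0 < X t l -> (forall j, l < j -> X t j = 0) ->
  airborne H X t != [::] /\ last 0 (airborne H X t) = X t.+1 l.+1.
Proof.
move=> lH Xl X0; rewrite /airborne (filter_iota_last _ l) // map_rcons last_rcons.
by split=> //; case: map.
Qed.

Lemma bad_walkP b n R P : 0 < n -> periodic_walk b n R P ->
  bad_walk (R 0, mkseq P n) <-> forall t, P t != [::] /\ last 0 (P t) = last 0 (R t).
Proof.
move=> n0 [Rc PR RS Rn Pn].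
have posl t : P t != [::] -> 0 < last 0 (R t).
  move=> Pt; move: (size_all2_leq _ _ (PR t)) (Rc t).
  case/lastP: (R t) => [|v k _ /andP[+ _]]; first by case: (P t) Pt.
  by rewrite all_rcons last_rcons => /andP[].
have RSl t : P t != [::] -> 0 < last 0 (P t) -> last 0 (R t.+1) = last 0 (P t).
  rewrite RS; case/lastP: (P t) => // p x _; rewrite last_rcons => x0.
  by rewrite /step /nz -rcons_cons filter_rcons x0 last_rcons.
split=> [/allP bad|bad]; last first.
  have lR t : last 0 (R t) = last 0 (R 0).
    elim: t => // t <-; have [Pt e] := bad t.
    by rewrite RSl // e posl.
  apply/allP => p /mapP[t _ ->] /=; have [-> ->] := bad t.
  by rewrite lR eqxx.
have bad' t : P t != [::] /\ last 0 (P t) = last 0 (R 0).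
  rewrite -(periodic_mod _ P n) //; set p := P _.
  have /bad/andP[-> /eqP] // : p \in mkseq P n.
  by apply/mapP; exists (t %% n); rewrite // mem_iota ltn_mod.
move=> t; have [Pt e] := bad' t; split=> //; rewrite e; case: t {Pt e} => // t.
have [Pt e] := bad' t; have [P0 _] := bad' 0.
by rewrite RSl // e // posl.
Qed.

Lemma state_good H b n X : 0 < n -> state H b n X ->
  ~~ bad_walk (parts H X 0, mkseq (airborne H X) n).
Proof.
move=> n0 st; have wk := state_walk _ _ _ _ st; apply/negP => /(bad_walkP _ _ _ _ n0 wk) bad.
have [Rc PR RS _ _] := wk; have [X0 Xb XS Xn] := st.
have top t : exists i, [/\ t <= i, 0 < X t i & forall j, i < j -> X t j = 0].
  elim: t => [|t [i [ti Xi X0i]]].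
    have [P0 _] := bad 0; move: P0; rewrite /airborne.
    case E: [seq _ <- _ | _] => [|i s] // _.
    have ex : exists i, 0 < X 0 i.
      by exists i; have := mem_head i s; rewrite -E mem_filter => /andP[].
    have ub j : 0 < X 0 j -> j <= H.
      by move=> Xj; rewrite leqNgt; apply/negP => /ltnW /(X0 0) e; rewrite e in Xj.
    case: (ex_maxnP ex ub) => m Xm mm; exists m; split=> // j mj.
    by apply/eqP; rewrite -leqn0 leqNgt; apply/negP => /mm; rewrite leqNgt mj.
  have iH : i < H by rewrite ltnNge; apply/negP => /(X0 t) e; rewrite e in Xi.
  have [Pt e] := bad t; have [_ e'] := last_airborne _ _ _ _ iH Xi X0i.
  exists i.+1; split=> //.
    rewrite -e' e; rewrite /parts nz_mkseq (filter_iota_last _ i) // map_rcons last_rcons //.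
  by case=> // j; rewrite ltnS => ij; apply/eqP; rewrite -leqn0 -(X0i j) // XS.
have [i [Hi Xi _]] := top H.
by rewrite X0 in Xi.
Qed.

Lemma lift_agree b P (x x' : nat -> nat -> nat) :
  (forall k i, x k.+1 i = lift b (x k) (P k) i) ->
  (forall k i, x' k.+1 i = lift b (x' k) (P k) i) ->
  forall k i, i < k -> x k i = x' k i.
Proof.
by move=> xS x'S; elim=> // k IH i ik; rewrite xS x'S; apply: eq_lift ik.
Qed.

Section Lift.
Context (b n N : nat) (R P : nat -> seq nat) (x : nat -> nat -> nat).
Hypotheses (n0 : 0 < n) (wk : periodic_walk b n R P)
  (xS : forall k i, x k.+1 i = lift b (x k) (P k) i)
  (xN : forall i, N <= i -> x 0 i = 0) (xR : nz (mkseq (x 0) N) = R 0).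

Lemma lift_inv k : nz (mkseq (x k) (N + k)) = R k /\ forall i, N + k <= i -> x k i = 0.
Proof.
have [Rc PR RS _ _] := wk.
elim: k => [|k [IH1 IH2]]; first by rewrite addn0.
have sb : sumn (R k) = b by case/andP: (Rc k) => _ /eqP.
rewrite addnS; split.
  have -> : mkseq (x k.+1) (N + k).+1 = mkseq (lift b (x k) (P k)) (N + k).+1.
    exact: eq_map (xS k) _.
  by rewrite nz_lift ?IH1.
case=> // i Nki; apply/eqP; rewrite -leqn0 -(IH2 i) // xS.
by apply: (lift_le _ _ _ (N + k)) => //; rewrite IH1.
Qed.

Lemma lift_mono k i : x k.+1 i.+1 <= x k i.
Proof.
have [_ PR _ _ _] := wk; have [e x0] := lift_inv k.
by rewrite xS; apply: (lift_le _ _ _ (N + k)) => //; rewrite e.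
Qed.

Lemma airborne_lift k : [seq x k.+1 i.+1 | i <- iota 0 (N + k) & 0 < x k i] = P k.
Proof.
have [_ PR _ _ _] := wk; have [e x0] := lift_inv k.
rewrite -[RHS](map_lift b (x k) _ (N + k)); first by apply: eq_map => i; rewrite xS.
by rewrite -size_nz_mkseq e; apply: size_all2_leq.
Qed.

Let F k := \sum_(i < N) x k (i + k).

Let F_mono k : F k.+1 <= F k.
Proof. by apply: leq_sum => i _; rewrite addnS lift_mono. Qed.

Let F_still k : F k.+1 = F k -> 0 < F k -> P k != [::] /\ last 0 (P k) = last 0 (R k).
Proof.
move=> Fk F0; have [e x0] := lift_inv k.
have ex : exists i, 0 < x k (i + k).
  case: (pickP (fun i : 'I_N => 0 < x k (i + k))) => [i xi|all0]; first by exists i.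
  by move: F0; rewrite /F big1 // => i _; apply/eqP; rewrite -leqn0 leqNgt all0.
have ub i : 0 < x k (i + k) -> i <= N.
  by move=> xi; rewrite leqNgt; apply/negP => Ni; rewrite x0 // leq_add2r ltnW in xi.
case: (ex_maxnP ex ub) => m xm mm.
have mN : m < N by rewrite ltnNge; apply/negP => Nm; rewrite x0 // leq_add2r in xm.
have above j : m + k < j -> x k j = 0.
  move=> mj; apply/eqP; rewrite -leqn0 leqNgt; apply/negP => xj.
  have kj : k <= j by apply: leq_trans (ltnW mj); apply: leq_addl.
  have := mm (j - k); rewrite subnK // => /(_ xj); rewrite leqNgt => /negP; apply.
  by rewrite ltn_subRL addnC.
have mkN : m + k < N + k by rewrite ltn_add2r.
rewrite -airborne_lift -e nz_mkseq (filter_iota_last _ (m + k)) // !map_rcons !last_rcons.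
split; first by case: map.
move: Fk; rewrite /F (bigD1 (Ordinal mN)) //= [RHS](bigD1 (Ordinal mN)) //= !addnS => Fk.
have l1 := lift_mono k (m + k).
suff : \sum_(i < N | i != Ordinal mN) x k.+1 (i + k).+1 <=
       \sum_(i < N | i != Ordinal mN) x k (i + k).
  move: Fk; under eq_bigr => i _ do rewrite addnS; move=> Fk Fle.
  apply/eqP; rewrite eqn_leq l1 /=; move: Fk l1 Fle.
  set A := \sum_(_ < _ | _) _; set B := \sum_(_ < _ | _) _; lia.
by apply: leq_sum => i _; apply: lift_mono.
Qed.

Lemma lift_old_vanish k i : ~~ bad_walk (R 0, mkseq P n) -> n * b <= k -> k <= i -> x k i = 0.
Proof.
move=> good nbk ki; have [Rc PR RS Rn Pn] := wk.
have Fle j k' : F (k' + j) <= F k'.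
  by elim: j => [|j IH]; rewrite ?addn0 // addnS; apply: leq_trans (F_mono _) IH.
have dec m : 0 < F (n * m) -> F (n * m + n) < F (n * m).
  move=> F0; rewrite ltn_neqAle Fle andbT; apply/negP => /eqP Fn.
  have same j : j <= n -> F (n * m + j) = F (n * m).
    move=> jn; apply/eqP; rewrite eqn_leq Fle /= -Fn.
    by rewrite -[X in n * m + X](subnKC jn) addnA; apply: Fle.
  move/negP: good; apply; apply/(bad_walkP _ _ _ _ n0 wk) => t.
  rewrite -(periodic_mod _ P n) // -(periodic_mod _ R n) //.
  rewrite -(periodic_mul _ P n m) // -(periodic_mul _ R n m) // addnC.
  have tn : t %% n < n by rewrite ltn_mod.
  by apply: F_still; rewrite -?addnS !same // ltnW.
have F0 : F 0 <= b.
  rewrite /F; under eq_bigr => j _ do rewrite addn0.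
  rewrite -sumn_mkseq -sumn_nz xR; by case/andP: (Rc 0) => _ /eqP->.
have Fm m : F (n * m) <= b - m.
  elim: m => [|m IH]; first by rewrite muln0 subn0.
  rewrite mulnS addnC; case: (posnP (F (n * m))) => [e|/dec lt].
    by rewrite (leq_trans (Fle n _)) // e.
  by have := leq_trans lt IH; rewrite subnS; case: (b - m).
have Fk : F k = 0.
  apply/eqP; rewrite -leqn0 -(subnn b); apply: leq_trans (Fm b).
  by rewrite -(subnKC nbk).
have [_ x0] := lift_inv k; case: (leqP (N + k) i) => [/x0 //|iNk].
have ikN : i - k < N by lia.
move: Fk; rewrite /F (bigD1 (Ordinal ikN)) //= subnK // => /eqP.
by rewrite addn_eq0 => /andP[/eqP].
Qed.

End Lift.

Lemma good_walk_state b n R P : 0 < n -> periodic_walk b n R P ->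
  ~~ bad_walk (R 0, mkseq P n) ->
  exists X, [/\ state (n * b.+1) b n X, forall t, parts (n * b.+1) X t = R t
                & forall t, airborne (n * b.+1) X t = P t].
Proof.
move=> n0 wk good; have [Rc PR RS Rn Pn] := wk.
pose N := size (R 0).
pose x := fix x k := if k is k'.+1 then lift b (x k') (P k') else nth 0 (R 0).
have xS k i : x k.+1 i = lift b (x k) (P k) i by [].
have xN i : N <= i -> x 0 i = 0 by move=> Ni; rewrite /= nth_default.
have xR : nz (mkseq (x 0) N) = R 0.
  by rewrite mkseq_nth nz_id //; case/andP: (Rc 0).
have inv := lift_inv _ _ _ _ _ _ wk xS xN xR.
pose x' k := x (n + k).
have x'S k i : x' k.+1 i = lift b (x' k) (P k) i by rewrite /x' addnS xS addnC Pn.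
have [x'R x'N] := inv n.
have x'0 : x' 0 = x n by rewrite /x' addn0.
have x'R' : nz (mkseq (x' 0) (N + n)) = R 0 by rewrite x'0 x'R -{1}[n]add0n Rn.
rewrite -x'0 in x'N.
have van := lift_old_vanish _ _ _ _ _ _ n0 wk xS xN xR.
have van' := lift_old_vanish _ _ _ _ _ _ n0 wk x'S x'N x'R'.
have per k i : n * b <= k -> x (k + n) i = x k i.
  move=> nbk; rewrite addnC -/(x' k i); case: (ltnP i k) => ik.
    exact: (lift_agree b P).
  by rewrite van ?van'.
pose X t := x (n * b + t); pose H := n * b.+1.
have Xn t i : X (t + n) i = X t i by rewrite /X addnA per // leq_addr.
have XH t i : H <= i -> X t i = 0.
  move=> Hi; rewrite -(periodic_mod _ (X^~ i) n) //.
  apply: van; rewrite ?leq_addr //; apply: leq_trans Hi.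
  by rewrite /H mulnS addnC leq_add2r ltnW // ltn_mod.
have supp t : [seq i <- iota 0 H | 0 < X t i] = [seq i <- iota 0 (N + (n * b + t)) | 0 < X t i].
  by have [_ x0] := inv (n * b + t); apply: filter_support => i; [apply: XH | apply: x0].
have Rm t : R (n * b + t) = R t by rewrite addnC (periodic_mul _ R).
have Pm t : P (n * b + t) = P t by rewrite addnC (periodic_mul _ P).
have XR t : parts H X t = R t.
  by rewrite /parts nz_mkseq supp -nz_mkseq -Rm; have [] := inv (n * b + t).
exists X; split=> //.
  split=> // [t|t i].
    by rewrite -sumn_mkseq -sumn_nz -/(parts H X t) XR; case/andP: (Rc t) => _ /eqP.
  by rewrite /X addnS (lift_mono _ _ _ _ _ _ wk xS xN xR).
move=> t; rewrite /airborne supp /X addnS.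
by rewrite (airborne_lift _ _ _ _ _ _ wk xS xN xR) Pm.
Qed.

Lemma state_uniq H b n X X' : 0 < n -> state H b n X -> state H b n X' ->
  mkseq (airborne H X) n = mkseq (airborne H X') n -> forall t i, X t i = X' t i.
Proof.
move=> n0 st st' e t i.
have [_ _ _ _ Pn] := state_walk _ _ _ _ st; have [_ _ _ _ Pn'] := state_walk _ _ _ _ st'.
have eP s : airborne H X s = airborne H X' s.
  rewrite -(periodic_mod _ (airborne H X) n) // -(periodic_mod _ (airborne H X') n) //.
  have sn : s %% n < n by rewrite ltn_mod.
  by have := congr1 (fun s' => nth [::] s' (s %% n)) e; rewrite !nth_mkseq.
have [_ _ _ Xn] := st; have [_ _ _ Xn'] := st'.
rewrite -(periodic_mul _ (X^~ i) n i.+1) // -(periodic_mul _ (X'^~ i) n i.+1) //.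
apply: (lift_agree b (airborne H X)) => [k j|k j|].
- exact: (state_lift _ _ _ _ _ _ st).
- by rewrite eP; apply: (state_lift _ _ _ _ _ _ st').
by rewrite ltn_addl // leq_pmull.
Qed.

(** * Siteswaps *)

(* Listing every multiset in increasing order picks one representative up to perm_eq. *)
Definition siteswap (b n : nat) (s : seq (seq nat)) : Prop :=
  [/\ is_mss n s, ball_sum s = n * b & all (sorted leq) s].

(* Time is reversed: M t are the throws leading from the state X t.+1 to the state X t. *)
Definition throws (M : nat -> seq nat) (X : nat -> nat -> nat) : Prop :=
  forall t h, count_mem h (M t) = if h is i.+1 then X t i - X t.+1 i.+1 else 0.

Lemma Mt_periodic s t : Mt s (t + size s) = Mt s t.
Proof. by rewrite /Mt modnDr. Qed.

Lemma Mt_small s t : t < size s -> Mt s t = nth [::] s t.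
Proof. by move=> ts; rewrite /Mt modn_small. Qed.

Lemma Mt_rev s t : t < size s -> Mt (rev s) t = Mt s (size s - t.+1).
Proof.
move=> ts; rewrite Mt_small ?size_rev // nth_rev // Mt_small //.
by rewrite ltn_subrL /=; apply: leq_ltn_trans ts.
Qed.

Lemma sum_count_mem (M : seq nat) (F : nat -> nat) H : (forall h, h \in M -> h <= H) ->
  \sum_(h <- M) F h = \sum_(h < H.+1) count_mem (val h) M * F h.
Proof.
elim: M => [|x M IH] MH; first by rewrite big_nil big1.
rewrite big_cons IH => [|h hM]; last by apply: MH; rewrite inE hM orbT.
have xH : x < H.+1 by rewrite ltnS MH ?mem_head.
under [RHS]eq_bigr => h _ do rewrite /= mulnDl.
rewrite big_split /=; congr (_ + _); rewrite (bigD1 (Ordinal xH)) //= eqxx mul1n big1 ?addn0 //.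
by move=> h nh; rewrite (_ : x == h = false) //; apply: contraNF nh => /eqP e; apply/eqP/val_inj.
Qed.

Lemma count_sum_count_mem (M : seq nat) (a : pred nat) H : (forall h, h \in M -> h <= H) ->
  count a M = \sum_(h < H.+1) count_mem (val h) M * a h.
Proof.
by move=> MH; rewrite -(sum_count_mem _ (fun h => nat_of_bool (a h)) _ MH) -sum1_count big_mkcond.
Qed.

Lemma ball_sum_rev s : ball_sum s = \sum_(t < size s) sumn (Mt (rev s) t).
Proof.
rewrite /ball_sum (reindex_inj rev_ord_inj) /=; apply: eq_bigr => t _.
by rewrite Mt_rev.
Qed.

Lemma landing_rev s t H : t < size s -> (forall t h, h \in Mt (rev s) t -> h <= H) ->
  \sum_(u < size s) count (fun h => (u + h) %% size s == size s - t.+1) (Mt s u) =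
  \sum_(h < H.+1) count_mem (val h) (Mt (rev s) (t + h)).
Proof.
move=> tn MH; set n := size s in tn *; set M := Mt (rev s) in MH *.
have Mn k : M (k + n) = M k by have := Mt_periodic (rev s) k; rewrite size_rev.
transitivity (\sum_(u < n) count (fun h => (t + h) %% n == u) (M u)).
  rewrite (reindex_inj rev_ord_inj) /=; apply: eq_bigr => u _.
  rewrite -Mt_rev //; apply: eq_count => h /=.
  have un := ltn_ord u.
  have tn' : n - t.+1 < n by lia.
  rewrite -{1}(modn_small tn').
  rewrite -(eqn_modDr (u + t.+1)) -[X in _ = (_ == X)](modn_small un).
  rewrite (_ : n - u.+1 + h + (u + t.+1) = t + h + n)
    1?(_ : n - t.+1 + (u + t.+1) = u + n); [|lia..].
  by rewrite !modnDr.
under eq_bigr => u _ do rewrite (count_sum_count_mem _ _ H (MH u)).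
rewrite exchange_big /=; apply: eq_bigr => h _.
have kn : (t + h) %% n < n by rewrite ltn_mod; lia.
rewrite (bigD1 (Ordinal kn)) //= eqxx muln1 big1 ?addn0 => [|u nu].
  by rewrite (periodic_mod _ M n).
rewrite (_ : _ == _ = false) ?muln0 //; apply: contraNF nu => /eqP e.
by apply/eqP/val_inj.
Qed.

Lemma sum_shift (f : nat -> nat) n : f n = f 0 -> \sum_(t < n) f t.+1 = \sum_(t < n) f t.
Proof.
move=> fn; apply: (@addnI (f 0)).
have := big_ord_recl n (fun i => f (val i)) (op := addn) (idx := 0).
by move=> /= <-; rewrite big_ord_recr /= fn addnC.
Qed.

Lemma telescope_diag (X : nat -> nat -> nat) t i K : (forall t i, X t.+1 i.+1 <= X t i) ->
  \sum_(j < K) (X (t + j) (i + j) - X (t + j).+1 (i + j).+1) + X (t + K) (i + K) = X t i.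
Proof.
move=> XS; elim: K => [|K <-]; first by rewrite big_ord0 !addn0.
rewrite big_ord_recr /= !addnS -addnA; congr (_ + _); rewrite subnK //.
Qed.

Lemma throws_state M H b n X t i : state H b n X -> throws M X ->
  X t i = \sum_(j < H) count_mem (i + j).+1 (M (t + j)).
Proof.
move=> [X0 _ XS _] MX; rewrite -(telescope_diag X t i H XS) X0 ?leq_addl // addn0.
by apply: eq_bigr => j _; rewrite MX.
Qed.

Lemma sum_heights H n X : (forall t i, H <= i -> X t i = 0) ->
  (forall t i, X t.+1 i.+1 <= X t i) -> (forall t i, X (t + n) i = X t i) ->
  \sum_(t < n) \sum_(i < H) i.+1 * (X t i - X t.+1 i.+1) = \sum_(t < n) \sum_(i < H) X t i.
Proof.
move=> X0 XS Xn; pose Q t := \sum_(i < H) i * X t i.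
have Qn : Q n = Q 0 by apply: eq_bigr => i _; rewrite -[n]add0n Xn.
apply: (@addIn (\sum_(t < n) Q t.+1)); rewrite {2}sum_shift // -!big_split /=.
apply: eq_bigr => t _.
have -> : Q t.+1 = \sum_(i < H) i.+1 * X t.+1 i.+1.
  have := big_ord_recl H (fun i => val i * X t.+1 (val i)) (op := addn) (idx := 0).
  by rewrite big_ord_recr /= X0 // muln0 addn0 mul0n add0n.
rewrite -!big_split /=; apply: eq_bigr => i _.
by rewrite -mulnDr subnK // mulSn.
Qed.

Lemma throws_bound M H b n X t h : state H b n X -> throws M X -> h \in M t -> 0 < h <= H.
Proof.
move=> [X0 _ _ _] MX; rewrite -has_pred1 has_count MX; case: h => // i.
by case: (ltnP i H) => // Hi; rewrite X0.
Qed.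

Lemma state_siteswap H b n X s : 0 < n -> state H b n X -> size s = n ->
  all (sorted leq) s -> throws (Mt (rev s)) X -> siteswap b n s.
Proof.
move=> n0 st sz so MX; have [X0 Xb XS Xn] := st; set M := Mt (rev s) in MX.
have MH t h : h \in M t -> h <= H by move=> /(throws_bound _ _ _ _ _ _ _ st MX)/andP[].
have sumXH t : \sum_(i < H.+1) X t i = b by rewrite big_ord_recr /= X0 // addn0.
split=> //.
  split=> //; split=> t tn.
    have -> : Mt s t = M (n - t.+1) by rewrite /M Mt_rev sz; [congr Mt|]; lia.
    by apply/allP => h /(throws_bound _ _ _ _ _ _ _ st MX)/andP[].
  pose u := n - t.+1; have un : u < size s by rewrite /u; lia.
  have tE : t = size s - u.+1 by rewrite /u; lia.
  have := landing_rev s u H un MH; rewrite -tE sz => ->.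
  rewrite {1}tE -Mt_rev // -/M big_ord_recl /= MX add0n.
  rewrite -count_predT (count_sum_count_mem _ _ H (MH u)) big_ord_recl /= MX mul0n add0n.
  transitivity (X u.+1 0).
    apply: (@addIn (\sum_(i < H) X u.+1 i.+1)).
    have := sumXH u.+1; rewrite big_ord_recl /= => ->; rewrite -(Xb u) -big_split /=.
    by apply: eq_bigr => i _; rewrite muln1 MX subnK.
  rewrite (throws_state M H b n X _ _ st MX); apply: eq_bigr => i _.
  by rewrite !add0n addnS addSn.
rewrite ball_sum_rev sz -/M.
transitivity (\sum_(t < n) \sum_(i < H) i.+1 * (X t i - X t.+1 i.+1)).
  apply: eq_bigr => t _; rewrite sumnE (sum_count_mem _ _ H (MH t)) big_ord_recl /= muln0 add0n.
  by apply: eq_bigr => i _; rewrite MX mulnC.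
rewrite (sum_heights _ _ _ X0 XS Xn) (eq_bigr (fun=> b)) ?sum_nat_const ?card_ord //.
Qed.

Lemma leq_sumn x (p : seq nat) : x \in p -> x <= sumn p.
Proof. by elim: p => //= y p IH; rewrite inE => /orP[/eqP->|/IH]; lia. Qed.

Lemma siteswap_state b n s : 0 < n -> siteswap b n s ->
  exists X, [/\ state (n * b.+1) b n X, throws (Mt (rev s)) X &
    forall d, (forall t, Mt (rev s) (t + d) = Mt (rev s) t) -> forall t i, X (t + d) i = X t i].
Proof.
move=> n0 [[sz [pos land]] bs so]; set M := Mt (rev s); set H := n * b.+1.
have Mn t : M (t + n) = M t by rewrite -sz -(size_rev s) /M Mt_periodic.
have Mmod t : M t = Mt s (n - (t %% n).+1).
  by rewrite -(periodic_mod _ M n) // /M Mt_rev sz ?ltn_mod.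
have MH t h : h \in M t -> h <= n * b.
  move=> hM; rewrite -bs ball_sum_rev sz -(periodic_mod _ M n) // in hM *.
  have tn : t %% n < n by rewrite ltn_mod.
  by rewrite (bigD1 (Ordinal tn)) //= (leq_trans (leq_sumn _ _ hM)) // leq_addr.
have nbH : n * b < H by rewrite /H mulnS; lia.
have MH' t h : h \in M t -> h <= H by move=> /MH hb; apply: leq_trans hb (ltnW nbH).
have Mpos t : count_mem 0 (M t) = 0.
  rewrite Mmod; apply/eqP; rewrite -leqn0 leqNgt -has_count has_pred1; apply/negP.
  have nn : n - (t %% n).+1 < n by lia.
  by move=> h0; have := allP (pos _ nn) _ h0.
have Mbig t h : n * b < h -> count_mem h (M t) = 0.
  move=> bh; apply/eqP; rewrite -leqn0 leqNgt -has_count has_pred1; apply/negP => /MH.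
  by rewrite leqNgt bh.
pose X t i := \sum_(j < H) count_mem (i + j).+1 (M (t + j)).
have XE t i : X t i = count_mem i.+1 (M t) + X t.+1 i.+1.
  have := big_ord_recl H (fun j => count_mem (i + val j).+1 (M (t + val j)))
    (op := addn) (idx := 0).
  rewrite big_ord_recr /= Mbig; last by lia.
  rewrite addn0 -/(X t i) !addn0 => ->; congr (_ + _); apply: eq_bigr => j _.
  by rewrite addSn addnS addSn addnS.
have X0 t i : H <= i -> X t i = 0.
  by move=> Hi; apply: big1 => j _; apply: Mbig; lia.
have XS t i : X t.+1 i.+1 <= X t i by rewrite [X t i]XE leq_addl.
have Xd d : (forall t, M (t + d) = M t) -> forall t i, X (t + d) i = X t i.
  by move=> Md t i; apply: eq_bigr => j _; rewrite addnAC Md.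
have Xn := Xd n Mn.
have MX : throws M X by move=> t [|i]; rewrite ?Mpos // [X t i]XE addnK.
have szM t : size (M t) = X t.+1 0.
  rewrite -(periodic_mod _ M n) // -(periodic_mod _ (fun t => X t.+1 0) n); last first.
    by move=> k; rewrite -addSn Xn.
  have un : t %% n < n by rewrite ltn_mod.
  set u := t %% n in un *; have un' : u < size s by rewrite sz.
  have nu : n - u.+1 < n by lia.
  rewrite /M Mt_rev // sz land // -sz (landing_rev s u H un' MH') big_ord_recl /= -/M Mpos add0n.
  by apply: eq_bigr => j _; rewrite add0n addnS addSn.
have XC t : \sum_(i < H) X t i = \sum_(i < H) X 0 i.
  elim: t => // t <-.
  have -> : \sum_(i < H) X t.+1 i = \sum_(i < H.+1) X t.+1 i.
    by rewrite big_ord_recr /= X0 // addn0.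
  rewrite big_ord_recl /= -szM.
  rewrite -count_predT (count_sum_count_mem _ _ H (MH' t)) big_ord_recl /= Mpos mul0n add0n.
  by rewrite -big_split /=; apply: eq_bigr => i _; rewrite muln1 [RHS]XE.
exists X; split=> //; split=> // t; rewrite XC.
apply/eqP; rewrite -(eqn_pmul2l n0) -bs ball_sum_rev sz -/M; apply/eqP.
transitivity (\sum_(t < n) \sum_(i < H) X t i).
  rewrite [RHS](eq_bigr (fun=> \sum_(i < H) X 0 i)) => [|k _]; last exact: XC.
  by rewrite sum_nat_const card_ord.
rewrite -(sum_heights _ _ _ X0 XS Xn); apply: eq_bigr => k _.
rewrite sumnE (sum_count_mem _ _ H (MH' k)) big_ord_recl /= muln0 add0n.
by apply: eq_bigr => i _; rewrite MX mulnC.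
Qed.

Lemma count_flatten_nseq (f : nat -> nat) H h :
  count_mem h (flatten [seq nseq (f i) i.+1 | i <- iota 0 H]) =
  if h is i.+1 then (i < H) * f i else 0.
Proof.
elim: H => [|H IH]; first by case: h.
rewrite -[H.+1]addn1 iotaD map_cat flatten_cat count_cat IH add0n addn1 /= cats0 count_nseq.
case: h {IH} => [|i] //=; rewrite eqSS ltnS [i <= H]leq_eqVlt.
by case: (ltngtP i H) => [||->] /=; lia.
Qed.

Lemma state_throws H b n X : 0 < n -> state H b n X ->
  exists s, [/\ size s = n, all (sorted leq) s & throws (Mt (rev s)) X].
Proof.
move=> n0 [X0 Xb XS Xn].
pose m t := sort leq (flatten [seq nseq (X t i - X t.+1 i.+1) i.+1 | i <- iota 0 H]).
exists (rev (mkseq m n)); rewrite size_rev size_mkseq all_rev revK; split=> //.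
  by apply/allP => p /mapP[t _ ->]; apply: (sort_sorted leq_total).
move=> t h; rewrite /Mt size_mkseq nth_mkseq ?ltn_mod // /m.
rewrite (permP (permEl (perm_sort leq _))) count_flatten_nseq; case: h => // i.
rewrite (periodic_mod _ (X^~ i) n) // (periodic_mod _ (fun t => X t.+1 i.+1) n); last first.
  by move=> k; rewrite -addSn Xn.
by case: ltnP => Hi; rewrite ?mul1n // X0.
Qed.

Lemma throws_inj n s s' X X' : size s = n -> size s' = n -> all (sorted leq) s ->
  all (sorted leq) s' -> throws (Mt (rev s)) X -> throws (Mt (rev s')) X' ->
  (forall t i, X t i = X' t i) -> s = s'.
Proof.
move=> sz sz' so so' MX MX' XX'; apply: (can_inj revK).
apply: (@eq_from_nth _ [::]); rewrite !size_rev ?sz // => t tn.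
have sso (r : seq (seq nat)) : size r = n -> all (sorted leq) r -> sorted leq (nth [::] (rev r) t).
  by move=> rn /allP; apply; rewrite -mem_rev mem_nth // size_rev rn.
apply: (sorted_eq leq_trans anti_leq); rewrite ?sso //.
apply/allP => h _ /=; have := MX t h; have := MX' t h; rewrite !Mt_small ?size_rev ?sz ?sz' //.
by move=> -> ->; case: h => // i; rewrite !XX'.
Qed.

(** * Periods *)

Lemma rel_image (A B : eqType) (L : seq A) (Q : A -> B -> Prop) : uniq L ->
  (forall a, a \in L -> exists b, Q a b) ->
  (forall a a' b, Q a b -> Q a' b -> a = a') ->
  exists S : seq B, [/\ uniq S, size S = size L, forall b, b \in S -> exists2 a, a \in L & Q a b
    & forall a, a \in L -> exists2 b, b \in S & Q a b].
Proof.
move=> + + inj; elim: L => [|a L IH] /=; first by exists [::].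
move=> /andP[aL uL] ex; have [|S [uS sS S1 S2]] := IH uL.
  by move=> a' a'L; apply: ex; rewrite inE a'L orbT.
have [b Qb] := ex a (mem_head _ _); exists (b :: S); rewrite /= uS sS andbT; split=> //.
- by apply/negP => /S1[a' a'L /(inj _ _ _ Qb) e]; rewrite e a'L in aL.
- move=> b'; rewrite inE => /orP[/eqP->|/S1[a' a'L Q']]; first by exists a; rewrite ?mem_head.
  by exists a'; rewrite // inE a'L orbT.
- move=> a'; rewrite inE => /orP[/eqP->|/S2[b' b'S Q']]; first by exists b; rewrite ?mem_head.
  by exists b'; rewrite // inE b'S orbT.
Qed.

Lemma siteswap_enum b n : 0 < n -> exists S, [/\ uniq S, forall s, s \in S <-> siteswap b n s &
  size (closed_walks b n) = size S + \sum_(i < b) size (closed_walks i n)].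
Proof.
move=> n0; pose H := n * b.+1.
pose Q w s := exists2 X, state H b n X & [/\ w = (parts H X 0, mkseq (airborne H X) n),
  size s = n, all (sorted leq) s & throws (Mt (rev s)) X].
pose L := [seq w <- closed_walks b n | ~~ bad_walk w].
have [|w|w w' s|S [uS sS S1 S2]] := rel_image _ _ L Q.
- exact/filter_uniq/uniq_closed_walks.
- rewrite mem_filter => /andP[good /(closed_walksP _ _ _ n0)[R [P [wk we]]]].
  rewrite we in good *; have [X [st XR XP]] := good_walk_state _ _ _ _ n0 wk good.
  have [s [sz so MX]] := state_throws _ _ _ _ n0 st.
  exists s, X => //; split=> //; rewrite XR; congr pair.
  by apply: eq_map => t; rewrite XP.
- move=> [X st [-> _ _ MX]] [X' st' [-> _ _ MX']].
  have XX' t i : X t i = X' t i.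
    by rewrite (throws_state _ _ _ _ _ t i st MX) (throws_state _ _ _ _ _ t i st' MX').
  congr pair; first by rewrite /parts; congr nz; apply: eq_map => i.
  apply: eq_map => t; rewrite /airborne (eq_filter (a2 := fun i => 0 < X' t i)) => [|i].
    by apply: eq_map => i.
  by rewrite XX'.
have memS s : s \in S <-> siteswap b n s.
  split=> [/S1[w _ [X st [_ sz so MX]]]|ss]; first exact: state_siteswap st _ _ MX.
  have [X [st MX _]] := siteswap_state _ _ _ n0 ss.
  have [[sz _] _ so] := ss.
  pose w := (parts H X 0, mkseq (airborne H X) n).
  have wL : w \in L.
    rewrite mem_filter (state_good _ _ _ _ n0 st); apply/(closed_walksP _ _ _ n0).
    by exists (parts H X), (airborne H X); split=> //; apply: state_walk.
  have [s' s'S [X' st' [we sz' so' MX']]] := S2 w wL.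
  suff -> : s = s' by [].
  apply: (throws_inj n s s' X X') => //; apply: (state_uniq H b n) => //.
  by case: we.
exists S; split=> //; rewrite sS -(size_bad_walks _ _ n0) addnC.
by rewrite [size L]size_filter count_predC.
Qed.

Definition has_period (s : seq (seq nat)) (d : nat) : bool :=
  all (fun t => Mt s (t + d) == Mt s t) (iota 0 (size s)).

Definition primitive (s : seq (seq nat)) : bool :=
  all (fun d => ~~ has_period s d) (iota 1 (size s).-1).

Lemma has_periodP s d : 0 < size s ->
  reflect (forall t, Mt s (t + d) = Mt s t) (has_period s d).
Proof.
move=> s0; apply: (iffP allP) => [per t|per t _]; last exact/eqP.
have := per (t %% size s); rewrite mem_iota ltn_mod s0 => /(_ isT) /eqP.
by rewrite /Mt modnDml modn_mod.
Qed.

Lemma primitiveP s : reflect (forall d, 0 < d < size s -> ~~ has_period s d) (primitive s).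
Proof.
apply: (iffP allP) => H d; first by move=> ds; apply: H; rewrite mem_iota; lia.
by rewrite mem_iota => ds; apply: H; lia.
Qed.

Lemma Mt_mkseq (f : nat -> seq nat) n t : 0 < n -> (forall t, f (t + n) = f t) ->
  Mt (mkseq f n) t = f t.
Proof.
by move=> n0 fn; rewrite /Mt size_mkseq nth_mkseq ?ltn_mod // (periodic_mod _ f).
Qed.

Lemma mkseq_Mt s : mkseq (Mt s) (size s) = s.
Proof.
apply: (@eq_from_nth _ [::]); rewrite size_mkseq // => i si.
by rewrite nth_mkseq // Mt_small.
Qed.

Lemma Mt_rot s i t : i <= size s -> Mt (rot i s) t = Mt s (t + i).
Proof.
case: (posnP (size s)) => [/size0nil-> _|s0 si]; first by rewrite /Mt !nth_nil.
rewrite /Mt size_rot -modnDml; set u := t %% size s.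
have us : u < size s by rewrite ltn_mod.
rewrite /rot nth_cat size_drop nth_drop; case: ltnP => ui.
  by rewrite addnC modn_small //; lia.
rewrite nth_take; last by lia.
have -> : u + i = u - (size s - i) + size s by lia.
by rewrite modnDr modn_small //; lia.
Qed.

Lemma all_sorted_Mt s : 0 < size s -> all (sorted leq) s <-> forall t, sorted leq (Mt s t).
Proof.
move=> s0; split=> [/allP so t|so]; first by apply/so/mem_nth; rewrite ltn_mod.
by rewrite -(mkseq_Mt s); apply/allP => p /mapP[t _ ->].
Qed.

Lemma Mt_rev_eq d n u s : 0 < d -> 0 < n -> d %| n -> size u = d -> size s = n ->
  (forall t, Mt u t = Mt s t) -> forall t, Mt (rev u) t = Mt (rev s) t.
Proof.
move=> d0 n0 dn szu szs us t.
have -> : Mt (rev u) t = Mt u (d - (t %% d).+1).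
  rewrite -(periodic_mod _ (Mt (rev u)) d) ?Mt_rev ?szu ?ltn_mod // => k.
  by rewrite -szu -(size_rev u) Mt_periodic.
have -> : Mt (rev s) t = Mt s (n - (t %% n).+1).
  rewrite -(periodic_mod _ (Mt (rev s)) n) ?Mt_rev ?szs ?ltn_mod // => k.
  by rewrite -szs -(size_rev s) Mt_periodic.
rewrite -us /Mt szu; congr nth; apply/eqP; rewrite -(eqn_modDr (t %% n).+1).
have tn : t %% n < n by rewrite ltn_mod.
have td : t %% d < d by rewrite ltn_mod.
have e := divn_eq (t %% n) d; rewrite modn_dvdm // in e.
rewrite subnK // {1}e.
rewrite (_ : d - (t %% d).+1 + (t %% n %/ d * d + t %% d).+1 = (t %% n %/ d).+1 * d); last by lia.
by rewrite modnMl eq_sym -[_ == _]/(d %| n).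
Qed.

Lemma siteswap_resize b d n u s : 0 < d -> 0 < n -> d %| n -> size u = d -> size s = n ->
  (forall t, Mt u t = Mt s t) -> siteswap b d u <-> siteswap b n s.
Proof.
move=> d0 n0 dn szu szs us; have rus := Mt_rev_eq _ _ _ _ d0 n0 dn szu szs us.
have so : all (sorted leq) u <-> all (sorted leq) s.
  rewrite !all_sorted_Mt ?szu ?szs //; split=> so t; [rewrite -us|rewrite us]; exact: so.
split=> ss.
  have [X [[X0 Xb XS Xd] MX _]] := siteswap_state _ _ _ d0 ss; have [_ _ sou] := ss.
  apply: (state_siteswap (d * b.+1) b n X) => //; last 1 first.
  - by move=> t h; rewrite -rus.
  - split=> // t i; case/dvdnP: dn => k ->; rewrite mulnC.
    exact: (periodic_mul _ (X^~ i)).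
  - exact/so.
have [X [[X0 Xb XS Xn] MX Xd]] := siteswap_state _ _ _ n0 ss; have [_ _ sos] := ss.
apply: (state_siteswap (n * b.+1) b d X) => //; last 1 first.
- by move=> t h; rewrite rus.
- split=> //; apply: Xd => t; rewrite -!rus -szu -(size_rev u); exact: Mt_periodic.
- exact/so.
Qed.

Lemma siteswap_rot b n s i : 0 < n -> i <= n -> siteswap b n s -> siteswap b n (rot i s).
Proof.
move=> n0 iN ss; have [[sz _] _ so] := ss.
have [X [[X0 Xb XS Xn] MX _]] := siteswap_state _ _ _ n0 ss.
apply: (state_siteswap (n * b.+1) b n (fun t => X (t + (n - i)))) => //.
- by split=> [t j|t|t j|t j]; [apply: X0|apply: Xb|apply: XS|rewrite addnAC Xn].
- by rewrite size_rot.
- by rewrite all_cat andbC -all_cat cat_take_drop.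
by move=> t h; rewrite rev_rot /rotr size_rev sz Mt_rot ?size_rev ?sz ?leq_subr.
Qed.

Lemma finite_choice (A : Type) (a0 : A) (Q : nat -> A -> Prop) N :
  (forall d, d < N -> exists a, Q d a) -> exists f, forall d, d < N -> Q d (f d).
Proof.
elim: N => [|N IH] ex; first by exists (fun=> a0).
have [d dN|f Qf] := IH; first by apply: ex; apply: ltnW.
have [a Qa] := ex N (ltnSn N); exists (fun d => if d == N then a else f d) => d.
by rewrite ltnS leq_eqVlt; case: eqP => [-> //|_ /=]; apply: Qf.
Qed.

Lemma size_siteswaps b n (S : nat -> seq (seq (seq nat))) : 0 < n ->
  (forall d, 0 < d <= n -> uniq (S d)) ->
  (forall d, 0 < d <= n -> forall s, s \in S d <-> siteswap b d s) ->
  size (S n) = \sum_(d <- divisors n) count primitive (S d).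
Proof.
move=> n0 uS memS; pose L := [seq (d, u) | d <- divisors n, u <- [seq u <- S d | primitive u]].
have dn d : d \in divisors n -> [/\ 0 < d, d <= n & d %| n].
  by rewrite -dvdn_divisors // => dn; split=> //; [apply: dvdn_gt0 dn|apply: dvdn_leq].
have -> : \sum_(d <- divisors n) count primitive (S d) = size L.
  rewrite size_allpairs_dep sumnE big_map; apply: eq_bigr => d _.
  by rewrite size_filter.
pose f (x : nat * seq (seq nat)) := mkseq (Mt x.2) n.
have uL : uniq L.
  apply: allpairs_uniq_dep => [|d /dn[d0 dn' _]|[i w] [i' w'] _ _ /= [-> ->]] //.
    exact: divisors_uniq.
  by apply/filter_uniq/uS; rewrite d0.
have LP x : x \in L -> exists d u,
    [/\ x = (d, u), 0 < d <= n, d %| n, siteswap b d u & primitive u].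
  move=> /allpairsPdep[d [u [/dn[d0 dn' dvd]]]]; rewrite mem_filter => /andP[pu uSd] ->.
  by exists d, u; rewrite d0 dn'; split=> //; apply/memS; rewrite ?d0.
have Mtper d u : d %| n -> size u = d -> forall t, Mt u (t + n) = Mt u t.
  move=> /dvdnP[k ->] szu t; rewrite mulnC; apply: (periodic_mul _ (Mt u)) => t'.
  by rewrite -szu Mt_periodic.
rewrite -(size_map f L); apply/perm_size/uniq_perm.
- by rewrite uS // n0 leqnn.
- rewrite map_inj_in_uniq // => x x' /LP[d [u [-> d0 dn' [[szu _] _ _] pu]]].
  move=> /LP[d' [u' [-> d'0 d'n [[szu' _] _ _] pu']]] e.
  have Muu' t : Mt u t = Mt u' t.
    rewrite -(Mt_mkseq (Mt u) n t n0 (Mtper _ _ dn' szu)).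
    by rewrite -[RHS](Mt_mkseq (Mt u') n t n0 (Mtper _ _ d'n szu')); congr Mt.
  have nlt d1 d2 u1 u2 : 0 < d1 -> size u1 = d1 -> size u2 = d2 -> primitive u2 ->
      (forall t, Mt u1 t = Mt u2 t) -> d2 <= d1.
    move=> d10 sz1 sz2 /primitiveP p2 e12; rewrite leqNgt; apply/negP => lt.
    have d12 : 0 < d1 < size u2 by rewrite d10 sz2.
    move/negP: (p2 d1 d12); apply.
    apply/has_periodP; first by rewrite sz2; apply: leq_ltn_trans lt.
    by move=> t; rewrite -!e12 -sz1 Mt_periodic.
  have dd' : d = d'.
    apply/eqP; rewrite eqn_leq (nlt d' d u' u) ?(nlt d d' u u') //; lia.
  rewrite dd'; congr pair; rewrite -(mkseq_Mt u) -(mkseq_Mt u') szu szu' dd'.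
  exact: eq_map.
move=> s; apply/idP/mapP.
  move/memS; rewrite n0 leqnn => /(_ isT) ss; have [[sz _] _ _] := ss.
  have s0 : 0 < size s by rewrite sz.
  have ex : exists e, (0 < e) && has_period s e.
    by exists n; rewrite n0; apply/has_periodP => // t; rewrite -sz Mt_periodic.
  case: (ex_minnP ex) => e /andP[e0 /(has_periodP _ _ s0) pe] mine.
  have en : e %| n.
    rewrite /dvdn -leqn0 leqNgt; apply/negP => r0.
    have := mine (n %% e); rewrite r0 /= leqNgt ltn_mod e0 /= => /(_ _) /negP; apply=> //.
    apply/has_periodP => // t; rewrite -(periodic_mul _ (Mt s) e (n %/ e)) //.
    by rewrite -addnA addnC mulnC [_ + _ * _]addnC -divn_eq addnC -sz Mt_periodic.
  pose u := mkseq (Mt s) e.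
  have us t : Mt u t = Mt s t by rewrite Mt_mkseq.
  have szu : size u = e by rewrite size_mkseq.
  exists (e, u); last first.
    by rewrite /f /= -[LHS]mkseq_Mt sz; apply: eq_map => t; rewrite us.
  have e1 : 0 < e <= n by rewrite e0 dvdn_leq.
  apply/allpairsPdep; exists e, u; split=> //; first by rewrite -dvdn_divisors.
  rewrite mem_filter; apply/andP; split; last first.
    by apply/memS => //; apply/(siteswap_resize b e n u s).
  apply/primitiveP => d; rewrite szu => /andP[d0 de]; apply/negP => /has_periodP pd.
  have := mine d; rewrite d0 /= leqNgt de => /(_ _)/negP; apply=> //.
  by apply/has_periodP => // t; rewrite -!us pd // szu.
move=> [x /LP[d [u [-> /andP[d0 dn'] dvd ss pu]]] ->]; have [[szu _] _ _] := ss.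
apply/memS; first by rewrite n0 leqnn.
apply/(siteswap_resize b d n u) => //; rewrite ?size_mkseq // => t.
by rewrite Mt_mkseq //; apply: Mtper szu.
Qed.

(** * Rotation orbits *)

Lemma uniq_rotations s : primitive s -> uniq [seq rot i s | i <- iota 0 (size s)].
Proof.
move=> /primitiveP ps; rewrite map_inj_in_uniq ?iota_uniq //.
have neq i j : i < j -> j < size s -> rot i s <> rot j s.
  move=> ij js e; have s0 : 0 < size s by apply: leq_ltn_trans js.
  have ds : 0 < j - i < size s by lia.
  move/negP: (ps _ ds); apply; apply/has_periodP => // t.
  have := congr1 (fun r => Mt r (t + (size s - i))) e; rewrite !Mt_rot //; [|lia..].
  rewrite (_ : t + (size s - i) + i = t + size s); last by lia.
  rewrite (_ : t + (size s - i) + j = t + (j - i) + size s); last by lia.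
  by rewrite !Mt_periodic.
move=> i j; rewrite !mem_iota !add0n /= => si sj e.
by case: (ltngtP i j) => // [/neq|/neq]; [move=> /(_ sj)|move=> /(_ si)]; rewrite e.
Qed.

Lemma rot_rot_mod (T : eqType) (s : seq T) i j : i < size s -> j < size s ->
  exists2 k, k < size s & rot i (rot j s) = rot k s.
Proof.
move=> si sj; rewrite rot_add_mod //; try exact: ltnW.
case: leqP => ij; last by exists (i + j - size s) => //; lia.
case: (eqVneq (i + j) (size s)) => [->|ne]; last by exists (i + j) => //; lia.
by exists 0; rewrite ?rot_size ?rot0 //; apply: leq_ltn_trans si.
Qed.

Lemma rot_sym (T : eqType) (s : seq T) i : i < size s ->
  exists2 k, k < size s & s = rot k (rot i s).
Proof.
move=> si; case: (posnP i) => [->|i0]; first by exists 0; rewrite ?rot0 //; apply: leq_ltn_trans si.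
exists (size s - i); first by lia.
by rewrite -[LHS](rotK i) /rotr size_rot.
Qed.

Lemma rotation_reps n (L : seq (seq (seq nat))) : 0 < n -> uniq L ->
  (forall s, s \in L -> size s = n /\ primitive s) ->
  (forall s i, s \in L -> i < n -> rot i s \in L) ->
  exists reps, [/\ size L = n * size reps, uniq reps, {subset reps <= L},
    forall r r' i, r \in reps -> r' \in reps -> i < n -> r' = rot i r -> r = r' &
    forall s, s \in L -> exists r i, [/\ r \in reps, i < n & s = rot i r]].
Proof.
move=> n0; have [m] := ubnP (size L); elim: m L => // m IH L Lm uL Lp Lrot.
case: (posnP (size L)) => [/size0nil->|L0].
  by exists [::]; split; rewrite ?muln0.
have [s sL] : exists s, s \in L by case: (L) L0 => // s L' _; exists s; rewrite mem_head.
have [sz ps] := Lp s sL.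
pose O := [seq rot i s | i <- iota 0 n].
have OP r : reflect (exists2 i, i < n & r = rot i s) (r \in O).
  by apply: (iffP mapP) => -[i iN ->]; exists i; rewrite // mem_iota in iN *.
have Orot r i : i < n -> (rot i r \in O) -> size r = n -> r \in O.
  move=> iN /OP[j jn e] szr; apply/OP.
  have [k kr re] : exists2 k, k < size r & r = rot k (rot i r) by apply: rot_sym; rewrite szr.
  have ks : k < size s by rewrite sz -szr.
  have js : j < size s by rewrite sz.
  have [l ln el] := rot_rot_mod _ s k j ks js.
  by exists l; rewrite -?sz // re e el.
pose L' := [seq r <- L | r \notin O].
have LE : perm_eq L (O ++ L').
  apply: uniq_perm => //.
    rewrite cat_uniq filter_uniq // andbT /O -{1}sz uniq_rotations //=.
    by apply/hasPn => r; rewrite mem_filter => /andP[].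
  move=> r; rewrite mem_cat mem_filter; case rO: (r \in O) => //=.
  by case/OP: rO => i iN ->; rewrite Lrot.
have szL : size L = n + size L' by rewrite (perm_size LE) size_cat size_map size_iota.
have [|||r i|reps [szr ur sub inj cov]] := IH L'.
- rewrite ltnS in Lm; apply: leq_trans Lm.
  by rewrite szL -[(size L').+1]add1n leq_add2r.
- exact: filter_uniq.
- by move=> r; rewrite mem_filter => /andP[_ /Lp].
- rewrite !mem_filter => /andP[rO rL] iN; rewrite Lrot // andbT.
  by apply: contra rO => /Orot; apply=> //; have [] := Lp r rL.
have subL r : r \in reps -> r \in L /\ r \notin O by move=> /sub; rewrite mem_filter => /andP[].
have sO : s \in O by apply/OP; exists 0; rewrite ?rot0.
exists (s :: reps); split.
- by rewrite szL szr /= mulnS.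
- by rewrite /= ur andbT; apply/negP => /subL[_]; rewrite sO.
- by move=> r; rewrite inE => /orP[/eqP-> //|/subL[]].
- move=> r r' i; rewrite !inE => /orP[/eqP->|rr] /orP[/eqP->|rr'] iN //.
  + by move=> e; have [_ /negP[]] := subL _ rr'; rewrite e; apply/OP; exists i.
  + move=> e; have [rL /negP[]] := subL _ rr; apply: (Orot _ i) => //; first by rewrite -e.
    by have [] := Lp r rL.
  exact: inj.
move=> r rL; case rO: (r \in O).
  by case/OP: rO => i iN ->; exists s, i; rewrite mem_head.
have [|r' [i [r'r iN ->]]] := cov r; first by rewrite mem_filter rO.
by exists r', i; rewrite inE r'r orbT.
Qed.

Lemma has_ballsE n b s : 0 < n -> has_balls n b s <-> ball_sum s = n * b.
Proof.
move=> n0; have nn : (n%:R != 0 :> rat)%R by rewrite pnatr_eq0 -lt0n.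
rewrite /has_balls; split=> [/(canRL (divfK nn))|->].
  by rewrite -natrM => /eqP; rewrite eqr_nat mulnC => /eqP.
by rewrite natrM mulrC mulKf.
Qed.

Lemma Mt_sort s t : Mt (map (sort leq) s) t = sort leq (Mt s t).
Proof.
rewrite /Mt size_map; case: (ltnP (t %% size s) (size s)) => ts; first by rewrite (nth_map [::]).
by rewrite !nth_default ?size_map.
Qed.

Lemma siteswap_sort b n s : is_mss n s -> ball_sum s = n * b ->
  siteswap b n (map (sort leq) s).
Proof.
move=> [sz [pos land]] bs; split.
- split; first by rewrite size_map.
  split=> t tn; rewrite Mt_sort; first by rewrite all_sort pos.
  rewrite size_sort land //; apply: eq_bigr => u _; rewrite Mt_sort.
  by rewrite count_sort.
- rewrite -bs /ball_sum size_map; apply: eq_bigr => t _; rewrite Mt_sort.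
  by apply: perm_sumn; rewrite perm_sort.
- by apply/allP => p /mapP[q _ ->]; apply: (sort_sorted leq_total).
Qed.

Lemma siteswap_Mt_perm b n s s' t t' : 0 < n -> siteswap b n s -> siteswap b n s' ->
  perm_eq (Mt s t) (Mt s' t') -> Mt s t = Mt s' t'.
Proof.
move=> n0 [[sz _] _ so] [[sz' _] _ so'].
have [so_t _] := all_sorted_Mt s ltac:(by rewrite sz).
have [so_t' _] := all_sorted_Mt s' ltac:(by rewrite sz').
by apply: (sorted_eq leq_trans anti_leq); [apply: so_t|apply: so_t'].
Qed.

Lemma orbit_reps_siteswaps b n (S : seq (seq (seq nat))) : 0 < n -> uniq S ->
  (forall s, s \in S <-> siteswap b n s) ->
  exists2 reps, orbit_reps b n reps & count primitive S = n * size reps.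
Proof.
move=> n0 uS memS; pose L := [seq s <- S | primitive s].
have LP s : s \in L <-> siteswap b n s /\ primitive s.
  rewrite mem_filter; split=> [/andP[-> /memS]//|[/memS-> ->] //].
have [||s i|reps [szL ur sub inj cov]] := rotation_reps n L n0.
- exact: filter_uniq.
- by move=> s /LP[[[]]].
- move=> /LP[ss /primitiveP ps] iN; have [[sz _] _ _] := ss.
  apply/LP; split; first by apply: siteswap_rot => //; apply: ltnW.
  apply/primitiveP => d; rewrite size_rot => /ps; apply: contra => /has_periodP per.
  apply/has_periodP; first by rewrite sz.
  move=> t; rewrite size_rot sz in per; have := per n0 (t + (n - i)).
  rewrite !Mt_rot ?sz 1?ltnW //.
  have -> : t + (n - i) + d + i = t + d + n by lia.
  have -> : t + (n - i) + i = t + n by lia.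
  by rewrite -sz !Mt_periodic.
exists reps; last by rewrite -size_filter.
have repsP r : r \in reps -> siteswap b n r /\ primitive r by move=> /sub /LP.
split; [|split].
- move=> s /repsP[ss /primitiveP ps]; have [mss bs so] := ss; have [sz _] := mss.
  split=> //; split; first exact/has_ballsE.
  split=> //; split; first by move=> t _; rewrite -sz Mt_periodic.
  move=> d d0 per; rewrite leqNgt; apply/negP => dn.
  have ds : 0 < d < size s by rewrite d0 sz.
  move/negP: (ps d ds); apply; apply/allP => t; rewrite mem_iota => /andP[_ ts].
  by apply/eqP/(siteswap_Mt_perm b n) => //; apply: per.
- move=> i j ir jr [_ [k e]].
  have ri := mem_nth [::] ir; have rj := mem_nth [::] jr.
  have [si _] := repsP _ ri; have [sj _] := repsP _ rj.
  have [[szi _] _ _] := si; have [[szj _] _ _] := sj.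
  have kn : k %% n < n by rewrite ltn_mod.
  apply/eqP; rewrite -(nth_uniq [::] ir jr ur); apply/eqP/(inj _ _ (k %% n)) => //.
  rewrite -[LHS]mkseq_Mt -[RHS]mkseq_Mt size_rot szi szj; apply/eq_in_map => t.
  rewrite mem_iota => /andP[_ tn]; rewrite Mt_rot ?szi 1?ltnW //.
  have -> : Mt (nth [::] reps i) (t + k %% n) = Mt (nth [::] reps i) (t + k).
    by rewrite /Mt szi modnDmr.
  by apply: (siteswap_Mt_perm b n) => //; apply: e; rewrite szi.
move=> s [mss [/(has_ballsE _ _ _ n0) bs [_ [_ min]]]]; pose s' := map (sort leq) s.
have [sz _] := mss.
have ss' : siteswap b n s' by apply: siteswap_sort.
have [|r [i [rr iN e]]] := cov s'.
  apply/LP; split=> //; apply/primitiveP => d; rewrite size_map sz => /andP[d0 dn].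
  apply/negP => /has_periodP per; move: dn; rewrite ltnNge min // => t _.
  rewrite size_map sz in per; have := per n0 t.
  by rewrite !Mt_sort -(perm_sort leq) => ->; rewrite perm_sort.
have [sr _] := repsP r rr; have [[szr _] _ _] := sr.
exists r => //; split; first by rewrite sz szr.
exists i => t _; rewrite -Mt_rot ?szr 1?ltnW // -e Mt_sort.
by rewrite perm_sym perm_sort.
Qed.

Local Open Scope ring_scope.

Theorem theorem8 (b n : nat) (hn : (1 <= n)%N) :
  exists2 reps : seq (seq (seq nat)), orbit_reps b n reps &
    (size reps)%:R =
      n%:R^-1 *
      \sum_(d <- divisors n)
        (mobius (n %/ d))%:~R *
        ((\tr (Amx b ^+ d))%:~R - \sum_(i < b) (\tr (Amx i ^+ d))%:~R) :> rat.
Proof.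
pose Q d (S : seq (seq (seq nat))) := (0 < d)%N ->
  [/\ uniq S, forall s, s \in S <-> siteswap b d s &
    size (closed_walks b d) = (size S + \sum_(i < b) size (closed_walks i d))%N].
have [d _|S QS] := finite_choice _ [::] Q n.+1.
  case: (posnP d) => [->|d0]; first by exists [::].
  by have [S HS] := siteswap_enum b d d0; exists S.
have [uS memS _] := QS n (ltnSn n) hn.
have [reps repsP cnt] := orbit_reps_siteswaps b n (S n) hn uS memS.
exists reps => //.
have nn : n%:R != 0 :> rat by rewrite pnatr_eq0 -lt0n.
apply: (canRL (mulKf nn)); rewrite -natrM -cnt.
rewrite (mobius_inversion (fun d => (size (S d))%:R) (fun d => (count primitive (S d))%:R)) //.
  apply: eq_big_seq => d; rewrite -dvdn_divisors // => dn; congr (_ * _).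
  have d0 := dvdn_gt0 hn dn.
  have [_ _ E] := QS d (dvdn_leq hn dn : d < n.+1)%N d0.
  under eq_bigr => i _ do rewrite tr_Amx_exp.
  by rewrite tr_Amx_exp -!pmulrn E natrD -natr_sum addrK.
move=> d dn; have d0 := dvdn_gt0 hn dn; have dn' := dvdn_leq hn dn.
rewrite -natr_sum (size_siteswaps b d S) // => e /andP[e0 ed];
  by have [] := QS e (leq_trans ed dn' : e < n.+1)%N e0.
Qed.
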